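(* Let $p$ be a prime number and let $n\in\{0,1,2,3,5,7,9,15,27\}$. Then there exists a smooth cubic surface $S\subset\mathbb{P}^3$ defined over the field $\mathbb{Q}_p$ of $p$-adic numbers that contains exactly $n$ lines defined over $\mathbb{Q}_p$.
   Context: A smooth cubic surface over $\mathbb{Q}_p$ is the zero locus in $\mathbb{P}^3$ of a homogeneous polynomial of degree $3$ in four variables with coefficients in $\mathbb{Q}_p$ that is smooth (over an algebraic closure $\overline{\mathbb{Q}}_p$). Over $\overline{\mathbb{Q}}_p$ such a surface contains exactly $27$ lines; the lines being counted are those that are defined over $\mathbb{Q}_p$, i.e. those stable under $\mathrm{Gal}(\overline{\mathbb{Q}}_p/\mathbb{Q}_p)$. *)

(* Defs.v *)
From HB Require Import structures.
From mathcomp Require Import all_boot all_order all_algebra.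
From mathcomp Require Import boolp.
From mathcomp Require Import mpoly.

Set Implicit Arguments.
Unset Strict Implicit.
Unset Printing Implicit Defensive.

Import GRing.Theory.
Local Open Scope ring_scope.

Section PadicIntegers.

Variables (p : nat) (p_pr : prime p).

(* The inverse limit of the rings Z/p^(k+1), k : nat. Exponents start at 1     *)
(* because 'Z_1 is not the zero ring. The parameter p_pr is not used in the    *)
(* definition; it lets the instances below find the primality of p.            *)
Record padic_int := PadicInt {
  residue : forall k : nat, 'Z_(p ^ k.+1);
  residue_compat : forall k, (residue k.+1 : nat)%:R = residue k
}.

Lemma padic_intP (x y : padic_int) : (forall k, residue x k = residue y k) -> x = y.
Proof.
case: x y => [x xP] [y yP] /= exy.
have E : x = y by exact: functional_extensionality_dep.
by case: _ / E in yP *; congr PadicInt; exact: Prop_irrelevance.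
Qed.

HB.instance Definition _ := gen_eqMixin padic_int.
HB.instance Definition _ := gen_choiceMixin padic_int.

Lemma pexp_gt1 k : (1 < p ^ k.+1)%N.
Proof. by rewrite -{1}(exp1n k.+1) ltn_exp2r // prime_gt1. Qed.

Lemma natr_pexp_eq0 k n : (n%:R == 0 :> 'Z_(p ^ k.+1)) = (p ^ k.+1 %| n)%N.
Proof. by rewrite -val_eqE /= val_Zp_nat ?pexp_gt1. Qed.

Lemma natr_pexp_mod j k n : (j <= k)%N ->
  (n %% p ^ k.+1)%:R = n%:R :> 'Z_(p ^ j.+1).
Proof.
move=> lejk; rewrite [in RHS](divn_eq n (p ^ k.+1)) natrD natrM.
have /eqP -> : ((p ^ k.+1)%:R == 0 :> 'Z_(p ^ j.+1)).
  by rewrite natr_pexp_eq0 dvdn_exp2l.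
by rewrite mulr0 add0r.
Qed.

Definition reduction k (a : 'Z_(p ^ k.+2)) : 'Z_(p ^ k.+1) := (a : nat)%:R.

Lemma reduction_natr k n : reduction n%:R = n%:R :> 'Z_(p ^ k.+1).
Proof. by rewrite /reduction val_Zp_nat ?pexp_gt1 // natr_pexp_mod. Qed.

Lemma reductionD k : {morph @reduction k : a b / a + b}.
Proof.
by move=> a b; rewrite -[a]natr_Zp -[b]natr_Zp -natrD !reduction_natr natrD.
Qed.

Lemma reductionM k : {morph @reduction k : a b / a * b}.
Proof.
by move=> a b; rewrite -[a]natr_Zp -[b]natr_Zp -natrM !reduction_natr natrM.
Qed.

Lemma reductionN k : {morph @reduction k : a / - a}.
Proof.
move=> a; apply/eqP; rewrite -addr_eq0 -reductionD addNr.
by rewrite (reduction_natr k 0).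
Qed.

Lemma reduction_residue (x : padic_int) k : reduction (residue x k.+1) = residue x k.
Proof. exact: residue_compat. Qed.

Definition padic0 : padic_int :=
  @PadicInt (fun=> 0) (fun k => reduction_natr k 0).

Definition padic1 : padic_int :=
  @PadicInt (fun=> 1) (fun k => reduction_natr k 1).

Fact padic_opp_compat (x : padic_int) k :
  reduction (- residue x k.+1) = - residue x k.
Proof. by rewrite reductionN reduction_residue. Qed.

Definition padic_opp (x : padic_int) : padic_int :=
  PadicInt (padic_opp_compat x).

Fact padic_add_compat (x y : padic_int) k :
  reduction (residue x k.+1 + residue y k.+1) = residue x k + residue y k.
Proof. by rewrite reductionD !reduction_residue. Qed.

Definition padic_add (x y : padic_int) : padic_int :=
  PadicInt (padic_add_compat x y).

Fact padic_mul_compat (x y : padic_int) k :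
  reduction (residue x k.+1 * residue y k.+1) = residue x k * residue y k.
Proof. by rewrite reductionM !reduction_residue. Qed.

Definition padic_mul (x y : padic_int) : padic_int :=
  PadicInt (padic_mul_compat x y).

Fact padic_addA : associative padic_add.
Proof. by move=> x y z; apply: padic_intP => k /=; rewrite addrA. Qed.

Fact padic_addC : commutative padic_add.
Proof. by move=> x y; apply: padic_intP => k /=; rewrite addrC. Qed.

Fact padic_add0 : left_id padic0 padic_add.
Proof. by move=> x; apply: padic_intP => k /=; rewrite add0r. Qed.

Fact padic_addN : left_inverse padic0 padic_opp padic_add.
Proof. by move=> x; apply: padic_intP => k /=; rewrite addNr. Qed.

HB.instance Definition _ :=
  GRing.isZmodule.Build padic_int padic_addA padic_addC padic_add0 padic_addN.

Fact padic_mulA : associative padic_mul.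
Proof. by move=> x y z; apply: padic_intP => k /=; rewrite mulrA. Qed.

Fact padic_mulC : commutative padic_mul.
Proof. by move=> x y; apply: padic_intP => k /=; rewrite mulrC. Qed.

Fact padic_mul1 : left_id padic1 padic_mul.
Proof. by move=> x; apply: padic_intP => k /=; rewrite mul1r. Qed.

Fact padic_mulDl : left_distributive padic_mul padic_add.
Proof. by move=> x y z; apply: padic_intP => k /=; rewrite mulrDl. Qed.

Fact padic1_neq0 : padic1 != padic0.
Proof.
apply/eqP => /(congr1 (fun x => residue x 0)) /= /eqP.
by rewrite oner_eq0.
Qed.

HB.instance Definition _ := GRing.Zmodule_isComNzRing.Build padic_int
  padic_mulA padic_mulC padic_mul1 padic_mulDl padic1_neq0.

Lemma residueM (x y : padic_int) k : residue (x * y) k = residue x k * residue y k.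
Proof. by []. Qed.

Lemma residue_natr (x : padic_int) j k : (j <= k)%N ->
  (residue x k : nat)%:R = residue x j.
Proof.
elim: k => [|k IHk]; first by rewrite leqn0 => /eqP ->; rewrite natr_Zp.
rewrite leq_eqVlt => /predU1P[-> |]; first by rewrite natr_Zp.
rewrite ltnS => lejk; rewrite -(IHk lejk) -(residue_compat x k).
by rewrite val_Zp_nat ?pexp_gt1 // natr_pexp_mod.
Qed.

(* Invertibility is decided classically. *)
Definition padic_unit : {pred padic_int} :=
  fun x => `[< exists y : padic_int, y * x = 1 >].

Definition padic_inv (x : padic_int) : padic_int :=
  if pselect (exists y : padic_int, y * x = 1) is left ex then sval (cid ex)
  else x.

Fact padic_mulV : {in padic_unit, left_inverse 1 padic_inv *%R}.
Proof.
move=> x /asboolP xU; rewrite /padic_inv; case: pselect => // ex.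
exact: (svalP (cid ex)).
Qed.

Fact padic_unitP x y : y * x = 1 -> padic_unit x.
Proof. by move=> yx1; apply/asboolP; exists y. Qed.

Fact padic_inv_out : {in [predC padic_unit], padic_inv =1 id}.
Proof.
by move=> x /asboolP xNU; rewrite /padic_inv; case: pselect.
Qed.

HB.instance Definition _ := GRing.ComNzRing_hasMulInverse.Build padic_int
  padic_mulV padic_unitP padic_inv_out.

Lemma padic_neq0 (x : padic_int) : x != 0 -> exists k, residue x k != 0.
Proof.
move=> /eqP xN0; apply: contrapT => /forallNP x0; apply: xN0.
by apply: padic_intP => k; apply/eqP/negPn/negP; exact: x0.
Qed.

Lemma logn_residue (x : padic_int) j k : (j <= k)%N -> residue x j != 0 ->
  (0 < residue x k)%N && (logn p (residue x k) <= j)%N.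
Proof.
move=> lejk; rewrite -(residue_natr x lejk) natr_pexp_eq0 => xkN0.
have xk_gt0 : (0 < residue x k)%N.
  by rewrite lt0n; apply: contraNneq xkN0 => ->; rewrite dvdn0.
by move: xkN0; rewrite xk_gt0 pfactor_dvdn // -ltnNge ltnS.
Qed.

Fact padic_integral : GRing.integral_domain_axiom padic_int.
Proof.
move=> x y xy0; apply/orP; case: (eqVneq x 0) => [|xN0]; [by left|right].
case: (eqVneq y 0) => // yN0; exfalso.
have [i xi] := padic_neq0 xN0; have [j yj] := padic_neq0 yN0.
pose k := (i + j).+1.
have /andP[x_gt0 vx] := logn_residue (leqW (leq_addr j i) : i <= k)%N xi.
have /andP[y_gt0 vy] := logn_residue (leqW (leq_addl i j) : j <= k)%N yj.
have: (residue (x * y) k == 0) by rewrite xy0.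
rewrite residueM -[residue x k]natr_Zp -[residue y k]natr_Zp -natrM.
rewrite natr_pexp_eq0 pfactor_dvdn ?muln_gt0 ?x_gt0 // lognM //.
by rewrite leqNgt ltnS /k (leq_trans (leq_add vx vy)) // -addnS leq_addr.
Qed.

HB.instance Definition _ :=
  GRing.ComUnitRing_isIntegral.Build padic_int padic_integral.

Definition padic : fieldType := {fraction padic_int}.

End PadicIntegers.

Section Surfaces.

Variables (K : fieldType) (L : closedFieldType) (iota : {rmorphism K -> L}).

Definition algebraic_closure : Prop := forall x : L, algebraicOver iota x.

Definition galois_automorphism (sigma : {rmorphism L -> L}) : Prop :=
  bijective sigma /\ forall a : K, sigma (iota a) = iota a.

(* The value of F at a vector of homogeneous coordinates of a point of P^3(L). *)
Definition form_eval (F : {mpoly K[4]}) (v : 'rV[L]_4) : L :=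
  (map_mpoly iota F).@[fun i => v 0 i].

(* The Jacobian criterion over the algebraically closed field L. The zero form *)
(* is not smooth.                                                              *)
Definition smooth_surface (F : {mpoly K[4]}) : Prop :=
  forall v : 'rV[L]_4, v != 0 -> form_eval F v = 0 ->
    exists i : 'I_4, form_eval F^`M(i) v != 0.

(* A line of P^3 over L is a 2-dimensional subspace of L^4. *)
Definition is_line (ell : {vspace 'rV[L]_4}) : Prop := \dim ell = 2.

Definition line_in_surface (F : {mpoly K[4]}) (ell : {vspace 'rV[L]_4}) : Prop :=
  forall v, v \in ell -> form_eval F v = 0.

Definition galois_stable (ell : {vspace 'rV[L]_4}) : Prop :=
  forall sigma : {rmorphism L -> L}, galois_automorphism sigma ->
    forall v, v \in ell -> map_mx sigma v \in ell.

Definition exactly_n_rational_lines (F : {mpoly K[4]}) (n : nat) : Prop :=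
  exists s : seq {vspace 'rV[L]_4}, [/\ uniq s, size s = n &
    forall ell, ell \in s <->
      [/\ is_line ell, line_in_surface F ell & galois_stable ell]].

End Surfaces.

(* Main.v *)
(* A monic quintic h with distinct roots t_1, ..., t_5 such that t_i + t_j is   *)
(* nonzero for i <> j gives five points ((t_i^2 : 1), (t_i : 1)) of P^1 x P^1;  *)
(* their blow-up is the cubic surface                                           *)
(*   x^2 z + h_4 x^2 w + h_3 x y z + h_2 x y w + h_1 y^2 z + h_0 y^2 w           *)
(*     + x w^2 - y z^2 = 0,                                                      *)
(* which contains the skew lines x = y = 0 and z = w = 0. Over the ground field *)
(* K, every root of h in K gives three further lines, and every monic quadratic *)
(* factor of h over K gives one (for the pair of its roots); there are no       *)
(* others. So the surface has 2 + 3 a + (a choose 2) + b lines, where a and b   *)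
(* count the irreducible factors of h of degrees 1 and 2. Taking for h a        *)
(* product of polynomials (X - c)^m - p, which are irreducible over Q_p, yields *)
(* the values 2, 3, 5, 7, 9, 15 and 27. The values 0 and 1 come from the        *)
(* surfaces x^3 - p y^3 = z w (z + w) and                                       *)
(* x (x^2 - p y^2) = p z (z^2 - p w^2).                                         *)

Require Import Defs.
From HB Require Import structures.
From mathcomp Require Import all_boot all_order all_algebra.
From mathcomp Require Import boolp classical_sets.
From mathcomp Require Import mpoly ring zify separable.

Set Implicit Arguments.
Unset Strict Implicit.
Unset Printing Implicit Defensive.

Import GRing.Theory.
Local Open Scope ring_scope.

(** Write K for Q_p. A Galois-stable line has a basis over K ([galois_fixed],
    [galois_stable_descent]), so by [exactly_n_rational_linesP] it suffices to find the lines with a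
    K-basis on each surface. What enters about Q_p is characteristic 0 and [dvdn_of_padic_expr],
    which says that x^m = p^k forces m to divide k.

    The quintic surface is f + g = 0 with f of bidegree (2, 1) and g of bidegree (1, 2) in (x, y)
    and (z, w); over the closure, the five common zeros of f and g on P^1 x P^1 are the points
    attached to the roots of h. A line that meets x = y = 0 in one point lies in a plane x = t^2 y
    with t a root of h: each root gives the join of (t^2 : 1 : 0 : 0) and (0 : 0 : t : 1) and a
    residual line ([meeting_paramsP]). A line disjoint from x = y = 0 is the graph of a linear map
    (x, y) -> (z, w). Rank 0 gives z = w = 0, rank 1 gives one line in the plane z = t w for each
    root t, and rank 2 gives a homography through three of the five points, hence one line for each
    quadratic divisor of h ([graph_equations_solve]). Separability of h and the absence of opposite
    roots make the surface smooth ([quintic_form_smooth]) and the listed lines distinct.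

    A factor (X - c)^m - p with m at most 5 is irreducible: a root, or the norm from a quadratic
    factor, would contradict the valuation property. Hence the roots and quadratic divisors of a
    product of such factors can be listed.

    For 0 and 1 lines, a rational line meets the coordinate planes in rational points, where
    valuations force most coordinates to vanish ([no_line_surface_lines],
    [one_line_surface_lines]). *)

(** * The fixed field of the Galois group *)

Section FixedField.

Variables (K : fieldType) (L : closedFieldType) (iota : {rmorphism K -> L}).
Hypothesis algL : algebraic_closure iota.

(* A K-embedding of a subfield of L into L is encoded by its graph, a          *)
(* K-subalgebra of L * L.                                                      *)
Definition embedding_graph (G : set (L * L)) : Prop :=
  [/\ forall a, G (iota a, iota a),
      forall u v, G u -> G v -> G (u + v),
      forall u v, G u -> G v -> G (u * v)
    & forall y, G (0, y) -> y = 0].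

Definition graph_poly (G : set (L * L)) (A B : {poly L}) : Prop :=
  forall i, G (A`_i, B`_i).

Lemma embedding_graphN G u1 u2 :
  embedding_graph G -> G (u1, u2) -> G (- u1, - u2).
Proof.
move=> [GK _ GM _] Gu.
have: G (iota (-1) * u1, iota (-1) * u2) := GM _ _ (GK (-1)) Gu.
by rewrite rmorphN1 !mulN1r.
Qed.

Lemma embedding_graphD G a b c d : embedding_graph G ->
  G (a, b) -> G (c, d) -> G (a + c, b + d).
Proof. by case=> _ GD _ _; exact: GD. Qed.

Lemma embedding_graphM G a b c d : embedding_graph G ->
  G (a, b) -> G (c, d) -> G (a * c, b * d).
Proof. by case=> _ _ GM _; exact: GM. Qed.

Lemma embedding_graph0 G : embedding_graph G -> G (0, 0).
Proof. by case=> GK _ _ _; have := GK 0; rewrite rmorph0. Qed.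

Lemma embedding_graph1 G : embedding_graph G -> G (1, 1).
Proof. by case=> GK _ _ _; have := GK 1; rewrite rmorph1. Qed.

Lemma embedding_graph_inj G a b b' :
  embedding_graph G -> G (a, b) -> G (a, b') -> b = b'.
Proof.
move=> gG Gb Gb'; have [_ GD _ G0] := gG.
have: G (a - a, b - b') := GD _ _ Gb (embedding_graphN gG Gb').
by rewrite subrr => /G0/eqP; rewrite subr_eq0 => /eqP.
Qed.

Lemma graph_poly_sum G (I : Type) (r : seq I) (P : pred I) (F F' : I -> L) :
  embedding_graph G -> (forall i, G (F i, F' i)) ->
  G (\sum_(i <- r | P i) F i, \sum_(i <- r | P i) F' i).
Proof.
move=> gG GF; elim/big_rec2: _ => [|i x y _ Gyx]; first exact: embedding_graph0.
exact: embedding_graphD.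
Qed.

Lemma graph_polyD G A A' B B' : embedding_graph G ->
  graph_poly G A A' -> graph_poly G B B' -> graph_poly G (A + B) (A' + B').
Proof.
by move=> gG GA GB i; rewrite !coefD; exact: embedding_graphD.
Qed.

Lemma graph_polyM G A A' B B' : embedding_graph G ->
  graph_poly G A A' -> graph_poly G B B' -> graph_poly G (A * B) (A' * B').
Proof.
move=> gG GA GB i; rewrite !coefM.
by apply: graph_poly_sum => // j; exact: embedding_graphM.
Qed.

Lemma graph_polyC G a b : embedding_graph G -> G (a, b) ->
  graph_poly G a%:P b%:P.
Proof.
by move=> gG Gab i; rewrite !coefC; case: eqP => // _; exact: embedding_graph0.
Qed.

Lemma graph_polyX G : embedding_graph G -> graph_poly G 'X 'X.
Proof.
move=> gG i; rewrite !coefX.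
by case: eqP => _; [exact: embedding_graph1 | exact: embedding_graph0].
Qed.

Lemma graph_polyXn G n : embedding_graph G -> graph_poly G 'X^n 'X^n.
Proof.
move=> gG i; rewrite !coefXn.
by case: eqP => _; [exact: embedding_graph1 | exact: embedding_graph0].
Qed.

Lemma graph_polyN G A A' : embedding_graph G ->
  graph_poly G A A' -> graph_poly G (- A) (- A').
Proof. by move=> gG GA i; rewrite !coefN; exact: (embedding_graphN gG (GA i)). Qed.

Lemma graph_poly_map G (q : {poly K}) :
  embedding_graph G -> graph_poly G (map_poly iota q) (map_poly iota q).
Proof. by move=> [GK _ _ _] i; rewrite coef_map; exact: GK. Qed.

Lemma graph_poly_horner G A A' x y : embedding_graph G ->
  graph_poly G A A' -> G (x, y) -> G (A.[x], A'.[y]).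
Proof.
move=> gG GA Gxy; rewrite (@horner_coef_wide _ (maxn (size A) (size A')) A x) ?leq_maxl //.
rewrite (@horner_coef_wide _ (maxn (size A) (size A')) A' y) ?leq_maxr //.
apply: graph_poly_sum => // i; apply: embedding_graphM => //.
elim: {i}(i : nat) => [|i IH]; first exact: embedding_graph1.
by rewrite !exprS; exact: embedding_graphM.
Qed.

Lemma graph_poly_eq0 G B : embedding_graph G -> graph_poly G 0 B -> B = 0.
Proof.
move=> [_ _ _ G0] GB; apply/polyP => i.
by rewrite coef0; apply: G0; have := GB i; rewrite coef0.
Qed.

(* Elements of L are algebraic over K, so a K-subalgebra is a field. *)
Lemma embedding_graphV G a b : embedding_graph G -> G (a, b) -> a != 0 ->
  exists c d, [/\ G (c, d), a * c = 1 & b * d = 1].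
Proof.
move=> gG Gab a0; have [GK _ _ G0] := gG.
have [q q0 qa] := algL a.
(* Dividing [q] by a power of X makes its constant term nonzero. Then q(a) = 0 reads a r(a) = -
   q(0), and q(b) = 0 as well because (0, q(b)) lies in [G]. *)
have {q q0 qa} [q q0 qa] :
    exists2 q : {poly K}, q`_0 != 0 & root (map_poly iota q) a.
  elim/poly_ind: q q0 qa => [|q c IH]; first by rewrite eqxx.
  have [-> | c0 _ qca] := eqVneq c 0; last first.
    by exists (q * 'X + c%:P); rewrite // coefD coefMX coefC add0r.
  rewrite addr0 mulf_eq0 polyX_eq0 orbF => q0.
  by rewrite rmorphM /= map_polyX rootM rootX (negPf a0) orbF; exact: IH.
have Dq : q = (q %/ 'X) * 'X + (q`_0)%:P.
  rewrite {1}[q](divp_eq q 'X); congr (_ + _).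
  by rewrite -['X]subr0 -[0]/(0%:P : {poly K}) modp_XsubC horner_coef0.
set r := map_poly iota (q %/ 'X); set c := iota q`_0.
have c0 : c != 0 by rewrite fmorph_eq0.
have Er x : (map_poly iota q).[x] = r.[x] * x + c.
  by rewrite Dq rmorphD rmorphM /= map_polyX map_polyC !hornerE.
have Gr : G (r.[a], r.[b]).
  by apply: graph_poly_horner => //; exact: graph_poly_map.
have qa0 : r.[a] * a + c = 0 by rewrite -Er; exact/eqP.
have qb0 : r.[b] * b + c = 0.
  apply: G0; rewrite -{1}qa0.
  exact: (embedding_graphD gG (embedding_graphM gG Gr Gab) (GK _)).
exists (- iota (q`_0)^-1 * r.[a]), (- iota (q`_0)^-1 * r.[b]); split.
- apply: (embedding_graphM gG) Gr; exact: (embedding_graphN gG (GK (q`_0)^-1)).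
- rewrite fmorphV -/c; apply: (mulfI c0).
  rewrite mulr1 -[RHS](addKr (r.[a] * a)) qa0 addr0.
  by field.
- rewrite fmorphV -/c; apply: (mulfI c0).
  rewrite mulr1 -[RHS](addKr (r.[b] * b)) qb0 addr0.
  by field.
Qed.

(** Division with remainder is carried out on both components with corresponding quotients, so a
    divisibility on the source side passes to the target side. *)
Lemma graph_poly_edivp G P P' A A' : embedding_graph G -> P != 0 ->
  graph_poly G P P' -> graph_poly G A A' ->
  exists Q Q' R R', [/\ graph_poly G Q Q', graph_poly G R R',
    A = Q * P + R, A' = Q' * P' + R' & (size R < size P)%N].
Proof.
move=> gG P0 GP; have [n] := ubnP (size A); elim: n A A' => // n IH A A' ltAn GA.
have [ltAP | lePA] := ltnP (size A) (size P).
  exists 0, 0, A, A'; rewrite !mul0r !add0r; split=> //.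
  by move=> i; rewrite !coef0; exact: embedding_graph0.
have [c [d [Gcd Pc _]]] : exists c d, [/\ G (c, d), lead_coef P * c = 1 &
    P'`_(size P).-1 * d = 1].
  by apply: embedding_graphV; rewrite ?lead_coef_eq0 //; exact: GP.
set k := (size A - size P)%N.
pose M := (lead_coef A * c)%:P * 'X^k; pose M' := (A'`_(size A).-1 * d)%:P * 'X^k.
have GMM : graph_poly G M M'.
  apply: graph_polyM => //; last exact: graph_polyXn.
  by apply: graph_polyC => //; exact: (embedding_graphM gG (GA _) Gcd).
have GB : graph_poly G (A - M * P) (A' - M' * P').
  by apply: graph_polyD => //; apply: graph_polyN => //; exact: graph_polyM.
have A0 : (0 < size A)%N by rewrite (leq_trans _ lePA) // size_poly_gt0.
have ltB : (size (A - M * P)%R < n)%N.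
  rewrite -ltnS; apply: leq_trans ltAn; rewrite ltnS -(prednK A0) ltnS.
  apply/leq_sizeP => j leAj; rewrite coefB -mulrA coefCM coefXnM.
  have P1 : (0 < size P)%N by rewrite size_poly_gt0.
  have [ltAj | leqj] := ltnP (size A).-1 j.
    have -> : A`_j = 0 by rewrite nth_default // -(prednK A0).
    case: ifP => [|/negbT]; first by rewrite mulr0 subrr.
    rewrite -leqNgt => lekj; rewrite (@nth_default _ _ P) ?mulr0 ?subrr //.
    by rewrite leq_subRL // /k subnK // -(prednK A0).
  have -> : j = (size A).-1 by apply/eqP; rewrite eqn_leq leAj leqj.
  have lekA : (k <= (size A).-1)%N.
    by rewrite /k -ltnS prednK // ltn_subrL P1.
  rewrite ltnNge lekA /=.
  have -> : ((size A).-1 - k = (size P).-1)%N.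
    by rewrite /k -!subn1 subnAC subKn.
  by rewrite -!lead_coefE -mulrA [c * _]mulrC Pc mulr1 subrr.
have [Q [Q' [R [R' [GQ GR DA DA' ltR]]]]] := IH _ _ ltB GB.
exists (Q + M), (Q' + M'), R, R'; split=> //; first exact: graph_polyD.
  by rewrite mulrDl addrAC -DA subrK.
by rewrite mulrDl addrAC -DA' subrK.
Qed.

(* The root y of P' can be any one, which gives the freedom to move x. *)
Lemma embedding_graph_extend G x y P P' : embedding_graph G ->
  graph_poly G P P' -> P != 0 -> root P x -> root P' y ->
  (forall A A', graph_poly G A A' -> A != 0 -> root A x ->
    (size P <= size A)%N) ->
  exists G', [/\ embedding_graph G', forall u, G u -> G' u & G' (x, y)].
Proof.
move=> gG GP P0 /rootP Px /rootP Py minP; have [GK _ _ _] := gG.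
exists (fun u => exists A A', graph_poly G A A' /\ u = (A.[x], A'.[y])).
split; last by exists 'X, 'X; split; [exact: graph_polyX | rewrite !hornerX].
  split.
  - move=> a; exists (iota a)%:P, (iota a)%:P; rewrite !hornerC.
    by split; first exact: graph_polyC.
  - move=> _ _ [A [A' [GA ->]]] [B [B' [GB ->]]].
    by exists (A + B), (A' + B'); rewrite !hornerD; split; first exact: graph_polyD.
  - move=> _ _ [A [A' [GA ->]]] [B [B' [GB ->]]].
    by exists (A * B), (A' * B'); rewrite !hornerM; split; first exact: graph_polyM.
  - move=> _ [A [A' [GA [Ax ->]]]].
    (* If A(x) = 0, minimality of [P] kills the remainder, so P' divides A' and A'(y) = 0: the new
       relation is single-valued. *)
    have [Q [Q' [R [R' [GQ GR DA -> ltR]]]]] := graph_poly_edivp gG P0 GP GA.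
    rewrite DA !hornerE Px mulr0 add0r in Ax.
    have R0 : R = 0.
      apply/eqP; apply: contraTT ltR => R0; rewrite -leqNgt.
      by apply: minP GR R0 _; rewrite rootE -Ax.
    by rewrite R0 in GR; rewrite (graph_poly_eq0 gG GR) !hornerE Py mulr0.
case=> a b Gab; exists a%:P, b%:P; rewrite !hornerC; split=> //.
exact: graph_polyC.
Qed.

(** A nonzero polynomial of least size serves as minimal polynomial over the domain of [G], without
    forming that subfield. *)
Lemma graph_minpoly G x : embedding_graph G ->
  exists P P', [/\ graph_poly G P P', P != 0, root P x &
    forall A A', graph_poly G A A' -> A != 0 -> root A x ->
      (size P <= size A)%N].
Proof.
move=> gG; pose S n := `[< exists A A',
  [/\ graph_poly G A A', A != 0, root A x & size A = n] >].
have exS : exists n, S n.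
  have [q q0 qx] := algL x; exists (size (map_poly iota q)); apply/asboolP.
  exists (map_poly iota q), (map_poly iota q); rewrite map_poly_eq0.
  by split=> //; exact: graph_poly_map.
case: (ex_minnP exS) => n /asboolP[P [P' [GP P0 Px sP]]] minP.
exists P, P'; split=> // A A' GA A0 Ax; rewrite sP; apply: minP.
by apply/asboolP; exists A, A'.
Qed.

(** A maximal graph given by Zorn's lemma is total, since [embedding_graph_extend] could otherwise
    adjoin one more element. *)
Lemma maximal_embedding_graph G1 : embedding_graph G1 ->
  exists G, [/\ embedding_graph G, forall u, G1 u -> G u &
    forall x, exists y, G (x, y)].
Proof.
move=> gG1.
pose good (G : set (L * L)) := embedding_graph G /\ forall u, G1 u -> G u.
have [F FP Ftot | G [PG maxG]] :=
    @Zorn_bigcup _ (fun G => G = set0 \/ good G).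
  have [[G [FG gG]] | noG] := pselect (exists G, F G /\ good G); last first.
    left; rewrite predeqE => u; split=> // -[G FG Gu].
    by case: (FP G FG) => [G0|gG]; [rewrite G0 in Gu | case: noG; exists G].
  right; split; last by move=> u G1u; exists G => //; exact: gG.2.
  have join u v : (\bigcup_(X in F) X)%classic u ->
      (\bigcup_(X in F) X)%classic v ->
      exists H, [/\ F H, embedding_graph H, H u & H v].
    move=> [H FH Hu] [H' FH' Hv].
    have gF H0 w : F H0 -> H0 w -> embedding_graph H0.
      by move=> /FP [-> //|[]].
    by have [sHH|sHH] := Ftot _ _ FH FH'; [exists H' | exists H];
      split=> //; try (exact: sHH); apply: gF; eassumption.
  split.
  - by move=> a; exists G => //; have [[GK _ _ _] _] := gG; exact: GK.
  - move=> u v Fu Fv; have [H [FH [_ HD _ _] Hu Hv]] := join _ _ Fu Fv.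
    by exists H => //; exact: HD.
  - move=> u v Fu Fv; have [H [FH [_ _ HM _] Hu Hv]] := join _ _ Fu Fv.
    by exists H => //; exact: HM.
  - move=> y Fy; have [H [FH [_ _ _ H0] Hy _]] := join _ _ Fy Fy.
    exact: H0.
have gG : good G.
  case: PG => // G0; case: (maxG G1); last by right; split.
  have G11 := embedding_graph1 gG1.
  by rewrite G0; split=> [u []|/(_ _ G11)].
exists G; split; [exact: gG.1 | exact: gG.2 | move=> x].
have [P [P' [GP P0 Px minP]]] := graph_minpoly x gG.1.
have [y P'y] : exists y, root P' y.
  apply/closed_rootP.
  have P1 : (1 < size P)%N by exact: root_size_gt1 P0 Px.
  have lP0 : lead_coef P != 0 by rewrite lead_coef_eq0.
  have [_ [d [_ _ P'd]]] := embedding_graphV gG.1 (GP (size P).-1) lP0.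
  apply: contra_eqN P'd => /eqP sP'.
  by rewrite nth_default ?mul0r ?sP' -?subn1 ?subn_gt0 // eq_sym oner_eq0.
have [G' [gG' sGG' G'xy]] := embedding_graph_extend gG.1 GP P0 Px P'y minP.
exists y; apply: contrapT => nGxy.
case: (maxG G'); last by right; split=> // u /gG.2 /sGG'.
by split=> [//| sG'G]; apply: nGxy; exact: sG'G.
Qed.

(** Surjectivity: an injective endomorphism over K maps the finite root set of a polynomial over K
    into itself, hence onto itself. *)
Lemma galois_automorphism_of_graph G : embedding_graph G ->
  (forall x, exists y, G (x, y)) ->
  exists2 sigma : {rmorphism L -> L}, galois_automorphism iota sigma &
    forall x y, G (x, y) -> sigma x = y.
Proof.
move=> gG Gtot; have [GK _ _ _] := gG.
pose f x := sval (cid (Gtot x)).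
have Gf x : G (x, f x) := svalP (cid (Gtot x)).
have fE x y : G (x, y) -> f x = y by exact: embedding_graph_inj gG (Gf x).
have fB : {morph f : x y / x - y}.
  move=> x y; apply: fE; apply: (embedding_graphD gG (Gf x)).
  exact: embedding_graphN.
have fM : monoid_morphism f.
  by split=> [|x y]; apply: fE; [exact: embedding_graph1 | exact: embedding_graphM].
pose sigma : {rmorphism L -> L} := HB.pack f
  (GRing.isZmodMorphism.Build L L f fB) (GRing.isMonoidMorphism.Build L L f fM).
have sK a : sigma (iota a) = iota a by exact: fE.
exists sigma => //; split=> //.
have surj y : exists x, sigma x = y.
  have [q q0 qy] := algL y.
  have qL0 : map_poly iota q != 0 by rewrite map_poly_eq0.
  have [r Dr] := closed_field_poly_normal (map_poly iota q).
  have rE z : (z \in undup r) = root (map_poly iota q) z.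
    by rewrite mem_undup Dr rootZ ?lead_coef_eq0 // root_prod_XsubC.
  have sr : {subset map sigma (undup r) <= undup r}.
    move=> _ /mapP[z + ->]; rewrite !rE => qz.
    have -> : map_poly iota q = map_poly sigma (map_poly iota q).
      by rewrite -map_poly_comp; apply: eq_map_poly => a; exact: esym (sK a).
    by rewrite fmorph_root.
  have usr : uniq (map sigma (undup r)).
    by rewrite map_inj_uniq ?undup_uniq //; exact: fmorph_inj.
  have [_ srE] := uniq_min_size usr sr (eq_leq (esym (size_map _ _))).
  have : y \in map sigma (undup r) by rewrite srE rE.
  by case/mapP=> x _ ->; exists x.
exists (fun y => sval (cid (surj y))) => [x|y]; last exact: (svalP (cid (surj y))).
by apply: (fmorph_inj sigma); exact: (svalP (cid (surj (sigma x)))).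
Qed.

(** The minimal polynomial of an element outside K has a second root, different from the first by
    separability; extending x -> y to an automorphism of L moves x. *)
Theorem galois_fixed x : (forall n, n.+1%:R != 0 :> K) ->
  (forall sigma, galois_automorphism iota sigma -> sigma x = x) ->
  exists a, x = iota a.
Proof.
move=> char0 fix_x; apply: contrapT => xNK.
pose G (u : L * L) := exists a, u = (iota a, iota a).
have gG : embedding_graph G.
  split.
  - by move=> a; exists a.
  - by move=> _ _ [a ->] [b ->]; exists (a + b); rewrite rmorphD.
  - by move=> _ _ [a ->] [b ->]; exists (a * b); rewrite rmorphM.
  - by move=> y [a [/esym/eqP]]; rewrite fmorph_eq0 => /eqP -> ->; rewrite rmorph0.
have [P [P' [GP P0 Px minP]]] := graph_minpoly x gG.
have PP' : P' = P by apply/polyP => i; have [a [-> ->]] := GP i.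
rewrite {P'}PP' in GP.
have PK i : exists a, P`_i = iota a by have [a [-> _]] := GP i; exists a.
have P2 : (2 < size P)%N.
  rewrite ltn_neqAle (root_size_gt1 P0 Px) andbT eq_sym; apply/eqP => sP.
  have [a Pa] := PK 0; have [b Pb] := PK 1.
  have b0 : iota b != 0 by rewrite -Pb; move: P0; rewrite -lead_coef_eq0 lead_coefE sP.
  move/rootP: Px; rewrite horner_coef sP !big_ord_recl big_ord0 /= Pa Pb.
  rewrite expr0 expr1 mulr1 addr0 => abx; apply: xNK; exists (- a / b).
  rewrite fmorph_div rmorphN; apply: (mulfI b0); rewrite [RHS]mulrC divfK //.
  by apply/eqP; rewrite -addr_eq0 addrC abx.
have [Q DP] := factor_theorem _ _ Px.
have Q0 : Q != 0 by apply: contraNneq P0 => Q0; rewrite DP Q0 mul0r.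
have [y Qy] : exists y, root Q y.
  apply/closed_rootP; move: P2; rewrite DP size_Mmonic ?monicXsubC //.
  by rewrite size_XsubC addn2 /=; case: (size Q) => [|[|]].
have Py : root P y by rewrite DP rootM Qy.
(* If y = x, the derivative of [P] is a shorter polynomial over K that vanishes at x, and it is
   nonzero in characteristic 0. *)
have yNx : y != x.
  apply: contraTneq Qy => ->; apply/negP => Qx.
  have P'x : root P^`() x.
    by rewrite DP derivM derivXsubC mulr1 rootE !hornerE subrr mulr0 add0r.
  have GP' : graph_poly G P^`() P^`().
    move=> i; rewrite coef_deriv; have [a ->] := PK i.+1.
    by exists (a *+ i.+1); rewrite rmorphMn.
  have P'0 : P^`() != 0.
    apply/eqP => P'0; have: P^`()`_(size P).-2 = 0 by rewrite P'0 coef0.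
    rewrite coef_deriv.
    have -> : (size P).-2.+1 = (size P).-1 by case: (size P) P2 => [|[|]].
    move/eqP; rewrite -lead_coefE -mulr_natr mulf_eq0 lead_coef_eq0 (negPf P0) /=.
    rewrite -(rmorph_nat iota) fmorph_eq0.
    by case: (size P) P2 => [|[|[|m]]] // _; apply/negP; exact: char0.
  have := minP _ _ GP' P'0 P'x.
  by rewrite leqNgt lt_size_deriv.
have [G1 [gG1 sGG1 G1xy]] := embedding_graph_extend gG GP P0 Px Py minP.
have [G2 [gG2 sG12 G2tot]] := maximal_embedding_graph gG1.
have [sigma galS sE] := galois_automorphism_of_graph gG2 G2tot.
by move/eqP: yNx; apply; rewrite -(sE _ _ (sG12 _ G1xy)); exact: fix_x.
Qed.

End FixedField.

(** * Descent of Galois-stable lines *)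

Section RowVspace.

Variables (E : fieldType) (m n : nat).
Implicit Types A B : 'M[E]_(m, n).

Definition row_vspace A : {vspace 'rV[E]_n} :=
  limg (linfun (mulmxr A) : 'Hom('rV[E]_m, 'rV[E]_n)).

Lemma mem_row_vspace A v : (v \in row_vspace A) = (v <= A)%MS.
Proof.
apply/memv_imgP/submxP => [[u _ ->]|[u ->]].
  by exists u; rewrite lfunE.
by exists u; rewrite ?memvf // lfunE.
Qed.

Lemma dim_row_vspace A : row_free A -> \dim (row_vspace A) = m.
Proof.
move=> freeA; rewrite /row_vspace limg_dim_eq; last first.
  apply/eqP; rewrite -subv0; apply/subvP => u; rewrite memv_cap memv_ker lfunE /=.
  case/andP=> _ /eqP uA0; rewrite memv0; apply/eqP.
  by apply: (row_free_inj freeA); rewrite uA0 mul0mx.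
by rewrite dimvf; exact: mul1n.
Qed.

Lemma eq_row_vspace A B : row_vspace A = row_vspace B -> (A :=: B)%MS.
Proof.
move=> eAB; apply/eqmxP; apply/andP; split; apply/row_subP => i;
  by rewrite -mem_row_vspace (eAB, =^~ eAB) mem_row_vspace row_sub.
Qed.

Lemma row_vspace_eqmx A B : (A :=: B)%MS -> row_vspace A = row_vspace B.
Proof. by move=> eAB; apply/vspaceP => v; rewrite !mem_row_vspace eAB. Qed.

Lemma row_vspaceP (V : {vspace 'rV[E]_n}) : \dim V = m ->
  exists2 A : 'M[E]_(m, n), row_free A & V = row_vspace A.
Proof.
move=> dimV; pose A : 'M[E]_(m, n) := \matrix_(i < m) (vbasis V)`_i.
have sz : size (vbasis V) = m by rewrite size_tuple.
have sVA : (V <= row_vspace A)%VS.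
  rewrite -(span_basis (vbasisP V)); apply/span_subvP => v.
  case/(nthP 0) => i; rewrite sz => lt_im <-.
  rewrite mem_row_vspace; apply: submx_trans (row_sub (Ordinal lt_im) A).
  by rewrite rowK.
have sAV : (row_vspace A <= V)%VS.
  apply/subvP => v; rewrite mem_row_vspace => /submxP[u ->].
  rewrite mulmx_sum_row memv_suml // => i _; rewrite memvZ // rowK.
  by apply/vbasis_mem/mem_nth; rewrite sz.
have VE : V = row_vspace A by apply/eqP; rewrite eqEsubv sVA.
exists A => //; rewrite -kermx_eq0; apply/eqP/row_matrixP => i.
have/eqP := limg_ker_dim (linfun (mulmxr A) : 'Hom('rV[E]_m, 'rV[E]_n)) fullv.
rewrite -/(row_vspace A) -VE dimV dimvf capfv (mul1n m : dim 'rV[E]_m = m).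
rewrite -[X in _ == X]add0n eqn_add2r dimv_eq0 => /eqP ker0.
apply/eqP; rewrite row0 -memv0 -ker0 memv_ker lfunE /=.
by rewrite -row_mul mulmx_ker row0.
Qed.

End RowVspace.

Section Descent.

Variables (K : fieldType) (L : closedFieldType) (iota : {rmorphism K -> L}).
Hypotheses (algL : algebraic_closure iota) (char0 : forall k, k.+1%:R != 0 :> K).

(* Once normalised to have an identity minor, a basis of a Galois-stable       *)
(* subspace is fixed by every Galois automorphism.                             *)
Lemma galois_stable_descent m (A : 'M[L]_(m, 4)) : row_free A ->
  galois_stable iota (row_vspace A) ->
  exists2 B : 'M[K]_(m, 4), row_free B & (A :=: map_mx iota B)%MS.
Proof.
move=> freeA stA.
have fullAT : row_full A^T by rewrite -col_leq_rank mxrank_tr (eqP freeA).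
pose f := fullrankfun fullAT.
have unitC : colsub f A \in unitmx.
  rewrite -unitmx_tr trmx_mxsub -row_full_unit.
  exact: fullrowsub_full.
pose N := invmx (colsub f A) *m A.
have NA : (N :=: A)%MS.
  by apply/eqmxP/eqmxMunitP; exists (invmx (colsub f A)); rewrite ?unitmx_inv.
have Nf : colsub f N = 1%:M by rewrite -mulmx_colsub mulVmx.
have sigmaN sigma : galois_automorphism iota sigma -> map_mx sigma N = N.
  move=> galS; have /submxP[X DX] : (map_mx sigma N <= N)%MS.
    apply/row_subP => i; rewrite -map_row NA -mem_row_vspace.
    by apply: stA => //; rewrite mem_row_vspace -NA row_sub.
  (* The automorphism fixes the identity minor, so the columns selected by [f] force the change of
     basis to be trivial. *)
  have X1 : X = 1%:M.
    by rewrite -[X]mulmx1 -Nf mulmx_colsub -DX -map_mxsub [mxsub _ _ N]Nf map_mx1.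
  by rewrite DX X1 mul1mx.
have NK i j : exists a, N i j = iota a.
  apply: (galois_fixed algL char0) => sigma /sigmaN/matrixP/(_ i j).
  by rewrite [LHS]mxE.
pose B := \matrix_(i, j) sval (cid (NK i j)).
have NB : N = map_mx iota B.
  by apply/matrixP => i j; rewrite [RHS]mxE [B i j]mxE; exact: (svalP (cid (NK i j))).
exists B; last by rewrite -NB; exact: eqmx_sym.
by rewrite -(row_free_map iota) -NB /row_free NA.
Qed.

Lemma map_row_galois_stable m (B : 'M[K]_(m, 4)) :
  galois_stable iota (row_vspace (map_mx iota B)).
Proof.
move=> sigma [_ sigmaK] v; rewrite !mem_row_vspace => /submxP[u ->].
rewrite map_mxM; apply/submxP; exists (map_mx sigma u); congr (_ *m _).
by apply/matrixP => i j; rewrite !mxE sigmaK.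
Qed.

(** After descent, completeness of a list of lines is a question over K, whereas the listed lines
    must lie on the surface over L. *)
Lemma exactly_n_rational_linesP (F : {mpoly K[4]}) (s : seq 'M[K]_(2, 4)) :
  uniq s -> {in s &, forall A B, (A :=: B)%MS -> A = B} ->
  (forall A, A \in s -> row_free A /\
    forall u : 'rV[L]_2, form_eval iota F (u *m map_mx iota A) = 0) ->
  (forall A : 'M[K]_(2, 4), row_free A ->
    (forall u : 'rV[K]_2, form_eval iota F (map_mx iota (u *m A)) = 0) ->
    exists2 B, B \in s & (A :=: B)%MS) ->
  exactly_n_rational_lines iota F (size s).
Proof.
move=> us inj_s sF Fs; exists (map (fun A => row_vspace (map_mx iota A)) s).
split.
- rewrite map_inj_in_uniq // => A B sA sB /eq_row_vspace eAB; apply: inj_s => //.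
  by apply/(map_eqmx iota).
- exact: size_map.
- move=> V; split.
    case/mapP=> A sA ->; have [freeA FA] := sF A sA; split.
    + by rewrite /is_line dim_row_vspace ?row_free_map.
    + by move=> v; rewrite mem_row_vspace => /submxP[u ->].
    + exact: map_row_galois_stable.
  case=> /row_vspaceP[A freeA ->] FA stA.
  have [B freeB eAB] := galois_stable_descent freeA stA.
  have [|C sC eBC] := Fs B freeB.
    move=> u; apply: FA; rewrite mem_row_vspace eAB map_mxM; exact: submxMl.
  apply/mapP; exists C => //; apply: row_vspace_eqmx.
  by apply: eqmx_trans eAB _; apply/map_eqmx.
Qed.

End Descent.

(** * The p-adic valuation *)

Section PadicValuation.

Variables (p : nat) (p_pr : prime p).
Local Notation Zp := (@Defs_padic_int__canonical__GRing_IntegralDomain p p_pr).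
Local Notation Qp := (padic p_pr).

(** Index 0 is the residue modulo p, so these are the elements of valuation 0. *)
Definition padic_punit (x : Zp) : bool := residue (x : padic_int p) 0 != 0.

Lemma residue_natmul n k : residue (n%:R : Zp) k = n%:R.
Proof. by elim: n => [//|n IH]; rewrite !mulrS -IH. Qed.

Lemma natr_padic_int_neq0 n : n.+1%:R != 0 :> Zp.
Proof.
apply/eqP => /(congr1 (fun x => residue x n)); rewrite residue_natmul => /eqP.
rewrite (natr_pexp_eq0 p_pr) => /(dvdn_leq (ltn0Sn n)); rewrite leqNgt.
by rewrite (ltn_expl _ (prime_gt1 p_pr)).
Qed.

Lemma natr_padic_neq0 n : n.+1%:R != 0 :> Qp.
Proof.
by rewrite -(rmorph_nat (@FracField.tofrac Zp)) tofrac_eq0 natr_padic_int_neq0.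
Qed.

Lemma p_padic_int_neq0 : p%:R != 0 :> Zp.
Proof. by have := natr_padic_int_neq0 p.-1; rewrite (prednK (prime_gt0 p_pr)). Qed.

Lemma padic_punitM x y : padic_punit x -> padic_punit y -> padic_punit (x * y).
Proof.
rewrite /padic_punit residueM -[residue x 0]natr_Zp -[residue y 0]natr_Zp -natrM.
rewrite !(natr_pexp_eq0 p_pr); move: (nat_of_ord _) (nat_of_ord _) => a b.
by rewrite expn1 Euclid_dvdM // negb_or => -> ->.
Qed.

Lemma padic_punitX x n : padic_punit x -> padic_punit (x ^+ n).
Proof.
move=> ux; elim: n => [|n IH]; first by rewrite /padic_punit oner_eq0.
by rewrite exprS padic_punitM.
Qed.

Lemma padic_int_divp (x : Zp) : ~~ padic_punit x -> exists y, x = p%:R * y.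
Proof.
rewrite negbK => /eqP x0.
have p_gt0 : (0 < p)%N := prime_gt0 p_pr.
have pE k : (p * (residue x k.+1 %/ p) = residue x k.+1)%N.
  rewrite mulnC divnK //.
  move/eqP: (residue_natr p_pr x (leq0n k.+1)).
  by rewrite x0 (natr_pexp_eq0 p_pr); move: (nat_of_ord _) => a; rewrite expn1.
(* Division by p costs one digit: the residue of x / p modulo p^(k+1) is read off from that of x
   modulo p^(k+2). *)
have compat k : reduction ((residue x k.+2 %/ p)%:R : 'Z_(p ^ k.+2)) =
    (residue x k.+1 %/ p)%:R :> 'Z_(p ^ k.+1).
  rewrite (reduction_natr p_pr).
  have := residue_compat x k.+1; move/(congr1 (@nat_of_ord _)).
  rewrite val_Zp_nat ?(pexp_gt1 p_pr) // => xk.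
  rewrite -xk -{2}(pE k.+1).
  by rewrite [(p ^ k.+2)%N]expnS -muln_modr mulKn // (natr_pexp_mod p_pr).
exists (PadicInt compat); apply: padic_intP => k.
rewrite residueM residue_natmul /= -natrM pE.
exact: esym (residue_natr p_pr x (leqnSn k)).
Qed.

Lemma padic_int_decomp (x : Zp) : x != 0 ->
  exists v u, x = p%:R ^+ v * u /\ padic_punit u.
Proof.
move=> /padic_neq0[k xk]; elim: k x xk => [|k IH] x xk.
  by exists 0, x; rewrite expr0 mul1r.
have [ux | /padic_int_divp[y xy]] := boolP (padic_punit x).
  by exists 0, x; rewrite expr0 mul1r.
have [|v [u [yE uu]]] := IH y.
  apply: contraNneq xk => yk; rewrite xy residueM residue_natmul.
  rewrite -[residue y k.+1]natr_Zp -natrM (natr_pexp_eq0 p_pr).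
  move/eqP: (residue_natr p_pr y (leqnSn k)); rewrite yk (natr_pexp_eq0 p_pr).
  by move: (nat_of_ord _) => a; rewrite [(p ^ k.+2)%N]expnS dvdn_pmul2l ?prime_gt0.
by exists v.+1, u; rewrite exprS -mulrA -yE.
Qed.

Lemma padic_valuation_le i j u w : p%:R ^+ i * u = p%:R ^+ j * w ->
  padic_punit u -> (j <= i)%N.
Proof.
move=> eq_uw uu; rewrite leqNgt; apply/negP => lt_ij.
move: eq_uw; rewrite -(subnKC (ltnW lt_ij)) exprD -mulrA.
move/(mulfI (expf_neq0 i p_padic_int_neq0)) => uE; move: uu.
rewrite uE -(prednK (_ : 0 < j - i)%N) ?subn_gt0 // exprS -mulrA /padic_punit.
rewrite residueM residue_natmul.
have /eqP-> : (p%:R == 0 :> 'Z_(p ^ 1)) by rewrite (natr_pexp_eq0 p_pr) expn1.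
by rewrite mul0r eqxx.
Qed.

Lemma padic_valuation_inj i j u w : p%:R ^+ i * u = p%:R ^+ j * w ->
  padic_punit u -> padic_punit w -> i = j.
Proof.
move=> e uu uw; apply/eqP; rewrite eqn_leq (padic_valuation_le e) //.
by rewrite (padic_valuation_le (esym e)).
Qed.

Lemma fracP (R : idomainType) (x : {fraction R}) :
  exists n d : R, d != 0 /\ x = FracField.tofrac n / FracField.tofrac d.
Proof.
elim/quotW: x => r; exists (frac r).1, (frac r).2.
have d0 : (frac r).2 != 0 by exact: denom_ratioP.
split=> //; apply: (mulIf (x := FracField.tofrac (frac r).2)).
  by rewrite tofrac_eq0.
rewrite divfK ?tofrac_eq0 //.
rewrite !piE; apply/eqmodP => /=.
rewrite /FracField.equivf /FracField.mulf /= !numden_Ratio ?mulr1 ?oner_eq0 //.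
by rewrite mulrC.
Qed.

(** With x = p^a u / (p^b w) for units u and w, comparing valuations gives m a = k + m b. *)
Lemma dvdn_of_padic_expr (x : Qp) m k : (0 < m)%N -> x ^+ m = p%:R ^+ k ->
  (m %| k)%N.
Proof.
move=> m_gt0; have [n [d [d0 ->]]] := fracP x.
have [-> | n0] := eqVneq n 0.
  rewrite tofrac0 mul0r expr0n eqn0Ngt m_gt0 => /esym/eqP.
  by rewrite expf_eq0 -(rmorph_nat (@FracField.tofrac Zp)) tofrac_eq0
    (negPf p_padic_int_neq0) andbF.
have [a [u [-> uu]]] := padic_int_decomp n0.
have [b [w [dE uw]]] := padic_int_decomp d0.
rewrite expr_div_n => /(canRL (divfK _)) E.
have {}E := E (expf_neq0 m (_ : FracField.tofrac d != 0)).
move: E; rewrite -(rmorph_nat (@FracField.tofrac Zp)) -!tofracXn -tofracM.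
rewrite tofrac_eq0 => /(_ d0)/eqP; rewrite tofrac_eq dE !exprMn -!exprM mulrA -exprD.
move=> /eqP/padic_valuation_inj/(_ (padic_punitX m uu) (padic_punitX m uw)) E.
by rewrite -(dvdn_addl _ (dvdn_mull b (dvdnn m))) -E dvdn_mull.
Qed.

End PadicValuation.

(** * Quadratic divisors *)

Section QuadraticDivisors.

Variable K : fieldType.
Implicit Types (p q : {poly K}) (a b r x : K) (s : seq K).

Definition quad a b : {poly K} := 'X^2 + a *: 'X + b%:P.

Lemma quadE a b : quad a b = 'X * ('X + a%:P) + b%:P.
Proof. by rewrite /quad -mul_polyC expr2 mulrDr [a%:P * _]mulrC. Qed.

Lemma horner_quad a b x : (quad a b).[x] = x ^+ 2 + a * x + b.
Proof. by rewrite !hornerE. Qed.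

Lemma size_quad a b : size (quad a b) = 3.
Proof.
rewrite /quad -addrA size_polyDl ?size_polyXn //.
rewrite (leq_ltn_trans (size_polyD _ _)) // gtn_max.
rewrite (leq_ltn_trans (size_scale_leq _ _)) ?size_polyX //.
by rewrite (leq_ltn_trans (size_polyC_leq1 _)).
Qed.

Lemma quad_monic a b : quad a b \is monic.
Proof.
rewrite monicE lead_coefE size_quad /quad !coefD coefXn coefZ coefX coefC.
by rewrite mulr0 !addr0.
Qed.

Lemma quad_eq a b a' b' : quad a b = quad a' b' -> (a, b) = (a', b').
Proof.
move=> e; have e0 := congr1 (fun p => p.[0]) e; have e1 := congr1 (fun p => p.[1]) e.
move: e0 e1; rewrite /= !horner_quad !expr0n !mulr0 !add0r !mulr1 => -> /eqP.
by rewrite (inj_eq (addIr _)) (inj_eq (addrI _)) => /eqP->.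
Qed.

Lemma monic_size3P p : p \is monic -> size p = 3 -> exists a b, p = quad a b.
Proof.
move=> /monicP mp sp; exists p`_1, p`_0; apply/polyP => i.
rewrite /quad !coefD coefXn coefZ coefX coefC.
case: i => [|[|[|i]]] /=; rewrite ?mulr0 ?mulr1 ?add0r ?addr0 //.
  by rewrite -mp lead_coefE sp.
by rewrite nth_default ?sp.
Qed.

Lemma quad_roots r r' : quad (- (r + r')) (r * r') = ('X - r%:P) * ('X - r'%:P).
Proof. by rewrite quadE rmorphN rmorphD rmorphM /=; ring. Qed.

Lemma root_quad_factor a b r : root (quad a b) r ->
  (a, b) = (- (r + (- a - r)), r * (- a - r)).
Proof.
rewrite rootE horner_quad => /eqP e; congr (_, _); first by ring.
by rewrite -[b]subr0 -{1}e; ring.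
Qed.

(** Each unordered pair of entries contributes the coefficients of (X - r)(X - r'). *)
Fixpoint root_pairs s : seq (K * K) :=
  if s is r :: s' then [seq (- (r + r'), r * r') | r' <- s'] ++ root_pairs s'
  else [::].

Lemma size_root_pairs s : size (root_pairs s) = 'C(size s, 2).
Proof.
by elim: s => //= r s IH; rewrite size_cat size_map IH binS bin1 addnC.
Qed.

Lemma mem_root_pairs s ab : uniq s -> (ab \in root_pairs s) <->
  exists r r', [/\ r \in s, r' \in s, r != r' & ab = (- (r + r'), r * r')].
Proof.
elim: s ab => [ab _|r s IH ab /= /andP[rNs us]]; first by split=> // -[? [? []]].
have {}IH ab' := IH ab' us; rewrite mem_cat; split.
  case/orP=> [/mapP[r' sr' ->] | /IH[x] [y [sx sy xy ->]]].
    exists r, r'; rewrite !inE eqxx sr' orbT; split=> //.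
    by apply: contraNneq rNs => ->.
  by exists x, y; rewrite !inE sx sy !orbT.
case=> x [y []]; rewrite !inE => /predU1P[-> | sx] /predU1P[-> | sy] xy ->.
- by rewrite eqxx in xy.
- by rewrite map_f.
- by rewrite addrC mulrC map_f.
- by apply/orP; right; apply/IH; exists x, y.
Qed.

Lemma uniq_root_pairs s : uniq s -> uniq (root_pairs s).
Proof.
elim: s => //= r s IH /andP[rNs us]; rewrite cat_uniq IH // andbT.
rewrite map_inj_uniq ?us /=; last by move=> x y [/oppr_inj/addrI].
apply/hasPn => ab /(mem_root_pairs _ us)[x [y [sx sy xy ->]]].
apply: contra rNs => /mapP[z sz]; case=> e1 e2.
have : root (quad (- (x + y)) (x * y)) r by rewrite e1 e2 quad_roots rootM root_XsubC eqxx.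
by rewrite quad_roots rootM !root_XsubC => /orP[]/eqP->.
Qed.

Lemma irreducible_coprime p q : irreducible_poly p -> irreducible_poly q ->
  ~~ (p %= q) -> coprimep p q.
Proof.
move=> [_ irr_p] [_ irr_q]; apply: contraR => ncop.
have dp := irr_p _ ncop (dvdp_gcdl p q); have dq := irr_q _ ncop (dvdp_gcdr p q).
by rewrite -(eqp_ltrans dp).
Qed.

Lemma irreducible_dvdp_prod p (I : eqType) (s : seq I) (F : I -> {poly K}) :
  irreducible_poly p -> p %| \prod_(i <- s) F i -> exists2 i, i \in s & p %| F i.
Proof.
move=> irr_p; elim: s => [|i s IH].
  rewrite big_nil dvdp1 => /eqP sp; have [] := irr_p; by rewrite sp.
rewrite big_cons; have [pFi _|pNFi] := boolP (p %| F i).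
  by exists i; rewrite // mem_head.
rewrite Gauss_dvdpr => [/IH[j sj pFj]|].
  by exists j; rewrite // inE sj orbT.
apply: contraR pNFi => ncop; have [_ /(_ _ ncop (dvdp_gcdl _ _)) e] := irr_p.
by rewrite -(eqp_dvdl _ e) dvdp_gcdr.
Qed.

Lemma irreducible_monic_dvdp p q : irreducible_poly q -> p \is monic ->
  q \is monic -> size p != 1 -> p %| q -> p = q.
Proof.
by move=> [_ irr_q] mp mq sp pq; apply/eqP; rewrite -eqp_monic //; exact: irr_q.
Qed.

(** In a proper factorisation in degree at most 5, one factor has degree 1 or 2. *)
Lemma irreducible_size_le6 p : p \is monic -> (1 < size p <= 6)%N ->
  ((2 < size p)%N -> forall x, ~~ root p x) ->
  ((3 < size p)%N -> forall a b, ~~ (quad a b %| p)) ->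
  irreducible_poly p.
Proof.
move=> mp /andP[p_gt1 p_le6] rp qp; split=> // q sq qp'.
have p0 : p != 0 by exact: monic_neq0.
have /dvdpP[t pE] := qp'.
have q0 : q != 0 by apply: contraNneq p0 => q0; rewrite pE q0 mulr0.
have t0 : t != 0 by apply: contraNneq p0 => t0; rewrite pE t0 mul0r.
have small u : u %| p -> size u = 2 \/ size u = 3 -> size u = size p.
  move=> up su; have u0 : u != 0.
    by apply: contraTneq up => ->; rewrite dvd0p.
  have [le_u] := dvdp_leq p0 up.
  apply/eqP; rewrite eqn_leq (dvdp_leq p0 up) /= leqNgt; apply/negP => lt_up.
  pose v := (lead_coef u)^-1 *: u.
  have lu : (lead_coef u)^-1 != 0 by rewrite invr_eq0 lead_coef_eq0.
  have mv : v \is monic by rewrite monicE lead_coefZ mulVf ?lead_coef_eq0.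
  have vp : v %| p by rewrite dvdpZl.
  have sv : size v = size u by rewrite size_scale.
  case: su => su; rewrite su in lt_up.
    have [x vx] : exists x, root v x.
      by have [x vx] := poly2_root (etrans sv su); exists x.
    by have /negP := rp lt_up x; apply; rewrite -dvdp_XsubCl (dvdp_trans _ vp) // dvdp_XsubCl.
  have [a [b vE]] := monic_size3P mv (etrans sv su).
  by have /negP := qp lt_up a b; apply; rewrite -vE.
rewrite -dvdp_size_eqp //.
have sz : size p = (size t + size q).-1 by rewrite pE size_mul.
have st := small t; have sq' := small q qp'.
have {}st : size t = 2 \/ size t = 3 -> size t = size p by apply: st; rewrite pE dvdp_mulr.
move: t0 q0; rewrite -!size_poly_gt0 => t0 q0.
apply/eqP; move: (size p) (size q) (size t) sz st sq' t0 q0 sq p_gt1 p_le6.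
(* Two factors of size at least 4 would have a product of size at least 7. *)
clear; move=> n a b ->; case: a => [|[|[|[|a]]]] //; case: b => [|[|[|[|b]]]] //=;
  rewrite ?addnS ?add0n ?addn0 //=; try (by move=> H; have := H (or_introl erefl));
  try (by move=> H; have := H (or_intror erefl));
  try (by move=> _ H; have := H (or_introl erefl));
  try (by move=> _ H; have := H (or_intror erefl)).
Qed.

End QuadraticDivisors.

(** * Products of shifted powers *)

Section QuinticFactors.

Variables (K : fieldType) (p : nat).
Hypotheses (p_gt0 : (0 < p)%N) (char0 : forall k, k.+1%:R != 0 :> K).
Hypothesis dvdn_of_expr : forall (x : K) m k,
  (0 < m)%N -> x ^+ m = p%:R ^+ k -> (m %| k)%N.

Definition shifted_power (d : nat * nat) : {poly K} :=
  ('X - d.1%:R%:P) ^+ d.2 - p%:R%:P.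

Local Notation phi := shifted_power.

Lemma natr_neq0 k : (0 < k)%N -> k%:R != 0 :> K.
Proof. by case: k => // k _; exact: char0. Qed.

Lemma horner_shifted_power d x : (phi d).[x] = (x - d.1%:R) ^+ d.2 - p%:R.
Proof. by rewrite !hornerE. Qed.

Lemma size_shifted_power d : (0 < d.2)%N -> size (phi d) = d.2.+1.
Proof.
move=> d2; have sd : size (('X - d.1%:R%:P) ^+ d.2 : {poly K}) = d.2.+1.
  by rewrite size_exp_XsubC.
rewrite size_polyDl sd // size_polyN (leq_ltn_trans (size_polyC_leq1 _)) //.
Qed.

Lemma shifted_power_monic d : (0 < d.2)%N -> phi d \is monic.
Proof.
move=> d2; rewrite monicE lead_coefDl.
  by have /monicP-> := monic_exp d.2 (monicXsubC (d.1%:R : K)).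
by rewrite size_polyN size_exp_XsubC (leq_ltn_trans (size_polyC_leq1 _)).
Qed.

Lemma shifted_power_noroot d x : (1 < d.2)%N -> ~~ root (phi d) x.
Proof.
move=> d2; apply/negP; rewrite rootE horner_shifted_power subr_eq0 => /eqP e.
have := dvdn_of_expr (ltnW d2) (e : _ = p%:R ^+ 1).
by rewrite dvdn1 => /eqP d1; rewrite d1 in d2.
Qed.

(* v ^ 2 - a u v + b u ^ 2 is the norm of u Y + v modulo Y ^ 2 + a Y + b. *)
Lemma expr_mod_quad (Y q : {poly K}) a b m :
  q = Y ^+ 2 + a%:P * Y + b%:P ->
  exists u v, q %| Y ^+ m - (u%:P * Y + v%:P) /\
    v ^+ 2 - a * u * v + b * u ^+ 2 = b ^+ m.
Proof.
move=> qE; elim: m => [|m [u [v [qm nm]]]].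
  exists 0, 1; split; last by ring.
  by rewrite expr0 mul0r add0r subrr dvdp0.
exists (v - a * u), (- (b * u)); split; last by rewrite [b ^+ _]exprS -nm; ring.
have -> : Y ^+ m.+1 - ((v - a * u)%:P * Y + (- (b * u))%:P) =
    Y * (Y ^+ m - (u%:P * Y + v%:P)) + u%:P * q.
  by rewrite qE exprS rmorphB rmorphN !rmorphM /=; ring.
by rewrite dvdp_add ?dvdp_mull.
Qed.

(** Modulo a quadratic divisor, (X - c)^m equals p; taking norms gives b'^m = p^2, so m divides
    2. *)
Lemma shifted_power_noquad d a b : (2 < d.2)%N -> ~~ (quad a b %| phi d).
Proof.
move=> d2; set c : K := d.1%:R; apply/negP => qd.
(* These are the coefficients of the quadratic as a polynomial in X - c. *)
pose a' := a + c *+ 2; pose b' := b + a * c + c ^+ 2.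
have qE : quad a b = ('X - c%:P) ^+ 2 + a'%:P * ('X - c%:P) + b'%:P.
  by rewrite quadE /a' /b' !(rmorphD, rmorphM, rmorphMn, rmorphXn) /=; ring.
have [u [v [qm nm]]] := expr_mod_quad d.2 qE.
have : quad a b %| u%:P * ('X - c%:P) + (v - p%:R)%:P.
  have -> : u%:P * ('X - c%:P) + (v - p%:R)%:P =
      phi d - (('X - c%:P) ^+ d.2 - (u%:P * ('X - c%:P) + v%:P)).
    by rewrite /phi rmorphB /=; ring.
  by rewrite dvdp_sub.
set r := _ + _ => qr.
have r0 : r = 0.
  apply/eqP; apply: contraTT qr => r0; apply/negP => /(dvdp_leq r0).
  rewrite size_quad leqNgt ltnS (leq_trans (size_polyD _ _)) // geq_max.
  rewrite (leq_trans (size_polyC_leq1 _)) // andbT mul_polyC.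
  by rewrite (leq_trans (size_scale_leq _ _)) // size_XsubC.
have rx x : u * (x - c) + (v - p%:R) = 0.
  by have := congr1 (horner^~ x) r0; rewrite /r !hornerE.
have v0 : v = p%:R.
  by apply/eqP; rewrite -subr_eq0 -(rx c) subrr mulr0 add0r.
have u0 : u = 0.
  by rewrite -(rx (c + 1)) v0 subrr addr0 addrAC subrr add0r mulr1.
have bE : b' ^+ d.2 = p%:R ^+ 2 by rewrite -nm v0 u0; ring.
have := dvdn_leq (ltn0Sn 1) (dvdn_of_expr (ltnW (ltnW d2)) bE).
by rewrite leqNgt d2.
Qed.

Lemma shifted_power_irreducible d : (0 < d.2 <= 5)%N -> irreducible_poly (phi d).
Proof.
move=> /andP[d2 d2le]; have mphi := shifted_power_monic d2.
apply: irreducible_size_le6; rewrite ?size_shifted_power //.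
- by rewrite !ltnS d2.
- by move=> ? x; exact: shifted_power_noroot.
- by move=> ? a b; exact: shifted_power_noquad.
Qed.

Lemma shifted_power_inj d d' : (0 < d.2)%N -> (0 < d'.2)%N -> phi d = phi d' -> d = d'.
Proof.
case: d d' => [c m] [c' m'] /= m0 m'0 e.
have em : m = m'.
  have := congr1 (fun q : {poly K} => size q) e; by rewrite !size_shifted_power // => -[].
rewrite -em in e *; congr (_, _).
have := congr1 (horner^~ c%:R) e; rewrite !horner_shifted_power /= subrr => /addIr.
rewrite expr0n eqn0Ngt m0 => /esym/eqP; rewrite expf_eq0 m0 subr_eq0 => /eqP ec.
wlog lec : c c' {e} ec / (c <= c')%N.
  by move=> H; have [/H->|/ltnW/H->] := leqP c c'.
apply/eqP; rewrite eqn_leq lec -subn_eq0 eqn0Ngt; apply/negP => /natr_neq0.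
by rewrite natrB // ec subrr eqxx.
Qed.

(* At c the equation (X - c)^m - p = k ((- X - c')^m' - p) becomes a vanishing *)
(* sum of positive integers.                                                   *)
Lemma shifted_power_reflect d d' : (0 < d.1)%N -> (0 < d'.1)%N ->
  (0 < d.2)%N -> (0 < d'.2)%N -> ~~ (phi d %= phi d' \Po - 'X).
Proof.
case: d d' => [c m] [c' m'] /= c0 c'0 m0 m'0; apply/negP => e.
have em : m = m'.
  have := eqp_size e; rewrite size_comp_poly2 ?size_polyN ?size_polyX //.
  by rewrite !size_shifted_power // => -[].
rewrite -{m'}em in e m'0.
have X2 : size (- 'X : {poly K}) = 2 by rewrite size_polyN size_polyX.
have lc : lead_coef (phi (c', m) \Po - 'X) = (-1) ^+ m.
  rewrite lead_coef_comp ?X2 // size_shifted_power // lead_coefN lead_coefX /=.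
  by rewrite (monicP (shifted_power_monic _)) // mul1r.
have [k [k0 ke]] : exists k, k != 0 /\ phi (c, m) = k *: (phi (c', m) \Po - 'X).
  have /eqpf_eq[k k0 ke] := e; by exists k.
have kE : k = (-1) ^+ m.
  have := congr1 lead_coef ke; rewrite lead_coefZ lc (monicP (shifted_power_monic _)) //.
  by move=> e1; apply: (mulIf (negbT (signr_eq0 K m))); rewrite -e1 -expr2 sqrr_sign.
have := congr1 (horner^~ c%:R) ke.
rewrite hornerZ horner_comp !horner_shifted_power /= hornerN hornerX subrr.
rewrite expr0n eqn0Ngt m0 /= sub0r kE mulrBr -exprMn mulN1r opprB opprK.
rewrite -natrD -natrX -signr_odd => /eqP; rewrite eq_sym -subr_eq0 opprK.
have n0 : (0 < (c' + c) ^ m)%N by rewrite expn_gt0 addn_gt0 c0 orbT.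
case: (odd m); rewrite ?expr1 ?expr0 ?mulN1r ?mul1r ?opprK ?subrK.
  by rewrite -!natrD; apply/negP/natr_neq0; rewrite !addn_gt0 n0.
by apply/negP/natr_neq0.
Qed.

Section Product.

Variable D : seq (nat * nat).
Hypotheses (uD : uniq D)
  (DP : forall d, d \in D -> [/\ (0 < d.1)%N, (0 < d.2)%N & (d.2 <= 5)%N]).

Definition shifted_power_prod : {poly K} := \prod_(d <- D) phi d.

Local Notation h := shifted_power_prod.

Lemma shifted_power_prod_irreducible d : d \in D -> irreducible_poly (phi d).
Proof. by case/DP=> _ d2 d2le; apply: shifted_power_irreducible; rewrite d2. Qed.

Lemma shifted_power_prod_monic : h \is monic.
Proof.
rewrite /h big_seq; apply: monic_prod => d /DP[_ d2 _].
exact: shifted_power_monic.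
Qed.

Lemma size_shifted_power_prod : size h = (\sum_(d <- D) d.2).+1.
Proof.
rewrite /h; elim: D DP => [_|d s IH sP]; first by rewrite !big_nil size_poly1.
have [_ d2 _] := sP d (mem_head _ _).
have sPs e : e \in s -> [/\ (0 < e.1)%N, (0 < e.2)%N & (e.2 <= 5)%N].
  by move=> se; apply: sP; rewrite inE se orbT.
rewrite !big_cons size_monicM ?shifted_power_monic ?size_shifted_power //.
  by rewrite IH // addSn addnS.
rewrite monic_neq0 // big_seq; apply: monic_prod => e /sPs[_ e2 _].
exact: shifted_power_monic.
Qed.

Lemma shifted_power_coprime d e : d \in D -> e \in D -> d != e ->
  coprimep (phi d) (phi e).
Proof.
move=> Dd De; apply: contraR => ncop.
have [[_ d2 _] [_ e2 _]] := (DP Dd, DP De).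
apply/eqP/shifted_power_inj => //; apply/eqP.
rewrite -eqp_monic ?shifted_power_monic //.
apply: contraR ncop => neq.
by apply: irreducible_coprime => //; exact: shifted_power_prod_irreducible.
Qed.

(** The derivative m (X - c)^(m-1) can vanish only at c, where the polynomial takes the value -
    p. *)
Lemma shifted_power_separable d : (0 < d.2)%N -> separable_poly (phi d).
Proof.
move=> d2; rewrite unlock derivB derivC subr0 deriv_exp derivXsubC mul1r.
rewrite -mulr_natr -polyC_natr mulrC mul_polyC coprimepZr ?natr_neq0 //.
rewrite coprimep_expr // coprimep_XsubC.
rewrite rootE horner_shifted_power subrr expr0n eqn0Ngt d2 /= sub0r oppr_eq0.
exact: natr_neq0.
Qed.

Lemma shifted_power_prod_separable : coprimep h h^`().
Proof.
suff: separable_poly h by rewrite unlock.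
have coprime_seq := shifted_power_coprime.
rewrite /h; elim: D uD DP coprime_seq => [|d s IH] /=.
  by move=> _ _ _; rewrite big_nil unlock derivC coprime1p.
case/andP=> dNs us sP cop; have [_ d2 _] := sP d (mem_head _ _).
rewrite big_cons separable_mul shifted_power_separable //= IH //; first last.
- by move=> a b sa sb; apply: cop; rewrite inE (sa, sb) orbT.
- by move=> a sa; apply: sP; rewrite inE sa orbT.
rewrite big_seq; apply: (big_ind (fun q => coprimep (phi d) q)).
- exact: coprimep1.
- by move=> a b da db; rewrite coprimepMr da.
- move=> e se; apply: cop; rewrite ?mem_head ?inE ?se ?orbT //.
  by apply: contraNneq dNs => ->.
Qed.

(** No two roots of h are opposite. Since X -> - X preserves irreducibility, it is enough to compare
    the factors pairwise. *)
Lemma shifted_power_prod_reflect : coprimep h (h \Po - 'X).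
Proof.
have sizeN (q : {poly K}) : size (q \Po - 'X) = size q.
  by rewrite size_comp_poly2 // size_polyN size_polyX.
have invol (q : {poly K}) : (q \Po - 'X) \Po - 'X = q.
  by rewrite -comp_polyA raddfN /= comp_polyX opprK comp_polyXr.
have irr_reflect (q : {poly K}) : irreducible_poly q -> irreducible_poly (q \Po - 'X).
  case=> q1 irr_q; split=> [|r r1 rq]; first by rewrite sizeN.
  have : r \Po - 'X %= q.
    apply: irr_q; first by rewrite sizeN.
    by rewrite -[q]invol dvdp_comp_poly.
  by case/andP=> qr rq'; rewrite /eqp rq -[r]invol dvdp_comp_poly.
rewrite /h rmorph_prod /= big_seq; apply: (big_ind (fun q => coprimep q _)).
- exact: coprime1p.
- by move=> a b da db; rewrite coprimepMl da.
move=> d Dd; rewrite big_seq; apply: (big_ind (fun q => coprimep _ q)).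
- exact: coprimep1.
- by move=> a b da db; rewrite coprimepMr da.
move=> e De; have [[d1 d2 _] [e1 e2 _]] := (DP Dd, DP De).
apply: irreducible_coprime; first exact: shifted_power_prod_irreducible.
  by apply: irr_reflect; exact: shifted_power_prod_irreducible.
exact: shifted_power_reflect.
Qed.

Definition product_roots : seq K := [seq d.1%:R + p%:R | d <- D & d.2 == 1].

Definition product_quads : seq (K * K) :=
  root_pairs product_roots ++
  [seq (- (d.1%:R *+ 2), d.1%:R ^+ 2 - p%:R) | d <- D & d.2 == 2].

Lemma natr_inj : injective (fun k : nat => k%:R : K).
Proof.
move=> a b; wlog le_ab : a b / (a <= b)%N.
  by move=> H; have [/H|/ltnW/H e /esym/e] := leqP a b.
move=> /eqP e; apply/eqP; rewrite eqn_leq le_ab -subn_eq0 eqn0Ngt.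
by apply/negP => /natr_neq0; rewrite natrB // (eqP e) subrr eqxx.
Qed.

Lemma product_rootsP x : (x \in product_roots) = root h x.
Proof.
apply/mapP/idP => [[d]|].
  rewrite mem_filter => /andP[/eqP d2 Dd] ->.
  rewrite /h (big_rem d) //= rootM rootE horner_shifted_power d2 expr1.
  by rewrite addrAC addrK subrr eqxx.
rewrite rootE /h horner_prod prodf_seq_eq0 => /hasP[d Dd /= dx].
have [_ d2_gt0 _] := DP Dd; have d2 : d.2 = 1.
  apply/eqP; move: d2_gt0; rewrite leq_eqVlt eq_sym => /orP[// | d2].
  by case/negP: (shifted_power_noroot x d2); exact: dx.
exists d; first by rewrite mem_filter Dd d2.
move: dx; rewrite horner_shifted_power d2.
by rewrite expr1 -addrA -opprD subr_eq0 => /eqP.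
Qed.

Lemma uniq_product_roots : uniq product_roots.
Proof.
rewrite map_inj_in_uniq ?filter_uniq // => -[a m] [b m'].
rewrite !mem_filter /= => /andP[/eqP-> _] /andP[/eqP-> _].
by move=> /addIr/natr_inj ->.
Qed.

Lemma phi_quad c : phi (c, 2) = quad (- (c%:R *+ 2)) (c%:R ^+ 2 - p%:R).
Proof.
by rewrite /phi quadE !(rmorphN, rmorphB, rmorphMn, rmorphXn) /=; ring.
Qed.

(** A quadratic divisor with a root splits, with distinct roots because h is separable; one without
    a root is irreducible, hence equal to one of the factors. *)
Lemma product_quadsP a b : ((a, b) \in product_quads) <-> (quad a b %| h).
Proof.
rewrite mem_cat; split.
  case/orP.
    move/mem_root_pairs => /(_ uniq_product_roots)[x [y [rx ry xy [-> ->]]]].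
    rewrite quad_roots Gauss_dvdp; last by rewrite coprimep_XsubC root_XsubC eq_sym.
    by rewrite !dvdp_XsubCl -!product_rootsP rx.
  case/mapP=> -[c m]; rewrite mem_filter /= => /andP[/eqP-> Dd] [-> ->].
  by rewrite -phi_quad /h (big_rem (c, 2)) //= dvdp_mulr.
move=> qh; have [[x qx]|noroot] := pselect (exists x, root (quad a b) x).
  apply/orP; left; apply/mem_root_pairs; first exact: uniq_product_roots.
  have ab := root_quad_factor qx; exists x, (- a - x).
  have qE : quad a b = ('X - x%:P) * ('X - (- a - x)%:P).
    by rewrite -quad_roots; case: ab => <- <-.
  have rx : root h x by rewrite -dvdp_XsubCl (dvdp_trans _ qh) // qE dvdp_mulr.
  have ry : root h (- a - x) by rewrite -dvdp_XsubCl (dvdp_trans _ qh) // qE dvdp_mull.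
  split; rewrite ?product_rootsP //; apply/eqP => xy.
  have [t hE] := dvdpP _ _ qh.
  have := coprimep_root shifted_power_prod_separable rx.
  rewrite hE qE -xy !derivM !derivXsubC mul1r mulr1 -mulr2n hornerD !hornerM.
  by rewrite hornerMn !hornerXsubC subrr mul0rn !mulr0 addr0 eqxx.
apply/orP; right.
have irr_q : irreducible_poly (quad a b).
  by apply: cubic_irreducible; rewrite ?size_quad // => x; apply/negP => qx;
    case: noroot; exists x.
have [[c m] Dd qd] := irreducible_dvdp_prod irr_q qh.
have [_ d2 _] := DP Dd.
have qE : quad a b = phi (c, m).
  apply: irreducible_monic_dvdp qd; rewrite ?quad_monic ?shifted_power_monic ?size_quad //.
  exact: shifted_power_prod_irreducible.
have m2 : m = 2.
  have := congr1 (fun q : {poly K} => size q) qE.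
  by rewrite size_quad size_shifted_power // => -[].
rewrite m2 in Dd qE; rewrite phi_quad in qE.
by apply/mapP; exists (c, 2); [rewrite mem_filter | exact: quad_eq].
Qed.

Lemma uniq_product_quads : uniq product_quads.
Proof.
rewrite cat_uniq uniq_root_pairs ?uniq_product_roots //=; apply/andP; split.
  apply/hasPn => ab /mapP[[c m]]; rewrite mem_filter /= => /andP[/eqP -> Dd] -> .
  apply/negP => /(mem_root_pairs _ uniq_product_roots)[x [y [_ _ _ [e1 e2]]]].
  case/negP: (@shifted_power_noroot (c, 2) x isT).
  by rewrite phi_quad e1 e2 quad_roots rootM root_XsubC eqxx.
rewrite map_inj_in_uniq ?filter_uniq // => -[a m] [b m'].
rewrite !mem_filter /= => /andP[/eqP-> _] /andP[/eqP-> _] [/oppr_inj e _].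
congr (_, _); move: e; rewrite -!mulrnA => /natr_inj/eqP.
by rewrite eqn_pmul2r // => /eqP.
Qed.

Lemma size_product_roots : size product_roots = count (fun d => d.2 == 1%N) D.
Proof. by rewrite size_map size_filter. Qed.

Lemma size_product_quads : size product_quads =
  ('C(count (fun d => d.2 == 1%N) D, 2) + count (fun d => d.2 == 2) D)%N.
Proof.
by rewrite size_cat size_root_pairs size_product_roots size_map size_filter.
Qed.

End Product.

End QuinticFactors.

(** * Cubic forms *)

Local Notation x_ := (@Ordinal 4 0 isT).
Local Notation y_ := (@Ordinal 4 1 isT).
Local Notation z_ := (@Ordinal 4 2 isT).
Local Notation w_ := (@Ordinal 4 3 isT).

Section CubicTerms.

Variable K : fieldType.
Implicit Types (c : K) (i j k l : 'I_4).

Definition cubic_term c i j k : {mpoly K[4]} := c *: ('X_i * 'X_j * 'X_k).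

Lemma cubic_term_homog c i j k : cubic_term c i j k \is 3.-homog.
Proof.
have X1 a : 'X_a \is [in K[4], 1.-homog] by rewrite dhomogX; apply/eqP; exact: mdeg1.
exact: (dhomogZ _ (dhomogM (dhomogM (X1 i) (X1 j)) (X1 k))).
Qed.

Variables (L : closedFieldType) (iota : {rmorphism K -> L}).

Lemma form_evalD F G v : form_eval iota (F + G) v = form_eval iota F v + form_eval iota G v.
Proof. by rewrite /form_eval rmorphD mevalD. Qed.

Lemma form_eval_cubic_term c i j k v :
  form_eval iota (cubic_term c i j k) v = iota c * (v 0 i * v 0 j * v 0 k).
Proof. by rewrite /form_eval map_mpolyZ !rmorphM /= !map_mpolyX mevalZ !mevalM !mevalXU. Qed.

Lemma mderivXU i j : ('X_i)^`M(j) = (i == j)%:R :> {mpoly K[4]}.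
Proof.
rewrite mderivX mnm1E; case: eqP => [->|_]; last by rewrite scale0r.
have -> : (U_(j) - U_(j) = 0)%MM by apply/mnmP => a; rewrite mnmBE subnn mnm0E.
by rewrite scale1r mpolyX0.
Qed.

Lemma form_eval_mderiv_cubic_term c i j k l v :
  form_eval iota ((cubic_term c i j k)^`M(l)) v =
  iota c * ((i == l)%:R * v 0 j * v 0 k + v 0 i * (j == l)%:R * v 0 k
            + v 0 i * v 0 j * (k == l)%:R).
Proof.
rewrite /form_eval /cubic_term mderivZ !mderivM !mderivXU map_mpolyZ mevalZ.
rewrite !(rmorphD, rmorphM, rmorph_nat) /= !map_mpolyX.
by rewrite !(mevalD, mevalM, mevalXU, rmorph_nat) /=; ring.
Qed.

End CubicTerms.

(** * Lines in standard position *)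

Section Lines.

Variable E : fieldType.
Implicit Types (u v : 'rV[E]_4) (A B : 'M[E]_(2, 4)).

Definition vec4 (a b c d : E) : 'rV[E]_4 := \row_j [:: a; b; c; d]`_j.

Definition span2 u v : 'M[E]_(2, 4) := \matrix_(i < 2) [:: u; v]`_i.

Lemma vec4E a b c d : ((vec4 a b c d 0 x_ = a) * (vec4 a b c d 0 y_ = b) *
  (vec4 a b c d 0 z_ = c) * (vec4 a b c d 0 w_ = d))%type.
Proof. by rewrite !mxE. Qed.

Lemma eq_vec4 u v : u 0 x_ = v 0 x_ -> u 0 y_ = v 0 y_ -> u 0 z_ = v 0 z_ ->
  u 0 w_ = v 0 w_ -> u = v.
Proof.
move=> ex ey ez ew; apply/rowP => -[[|[|[|[|//]]]] lt_j4].
- by rewrite (_ : Ordinal _ = x_) //; exact: val_inj.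
- by rewrite (_ : Ordinal _ = y_) //; exact: val_inj.
- by rewrite (_ : Ordinal _ = z_) //; exact: val_inj.
- by rewrite (_ : Ordinal _ = w_) //; exact: val_inj.
Qed.

Lemma mul_span2 (k : 'rV[E]_2) u v : k *m span2 u v = k 0 0 *: u + k 0 1 *: v.
Proof.
rewrite mulmx_sum_row !big_ord_recl big_ord0 addr0 !rowK /=.
by congr (_ + k 0 _ *: _); exact: val_inj.
Qed.

Lemma sub_span2P u v r :
  reflect (exists s t, r = s *: u + t *: v) (r <= span2 u v)%MS.
Proof.
apply: (iffP submxP) => [[k ->]|[s [t ->]]].
  by exists (k 0 0), (k 0 1); rewrite mul_span2.
by exists (\row_j [:: s; t]`_j); rewrite mul_span2 !mxE.
Qed.

Lemma span2_sub m u v (A : 'M[E]_(m, 4)) :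
  (span2 u v <= A)%MS = (u <= A)%MS && (v <= A)%MS.
Proof.
apply/row_subP/andP => [H | [uA vA] i].
  by have := H 1; have := H 0; rewrite !rowK.
by rewrite rowK; case: i => -[|[|//]] lt_i2.
Qed.

Lemma row_free_span2 u v :
  (forall s t, s *: u + t *: v = 0 -> s = 0 /\ t = 0) -> row_free (span2 u v).
Proof.
move=> indep; apply: inj_row_free => k; rewrite mul_span2 => /indep[k0 k1].
apply/rowP => -[[|[|//]] lt_j2]; rewrite mxE.
- by rewrite -[RHS]k0; congr (k _ _); exact: val_inj.
- by rewrite -[RHS]k1; congr (k _ _); exact: val_inj.
Qed.

Lemma complete_span2 A v : row_free A -> (v <= A)%MS -> v != 0 ->
  exists2 u, (u <= A)%MS & (A :=: span2 u v)%MS.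
Proof.
move=> freeA vA v0.
have rkv : \rank v = 1 by apply/eqP; rewrite eqn_leq rank_leq_row lt0n mxrank_eq0.
have [i iNv] : exists i, ~~ (row i A <= v)%MS.
  apply/existsP; rewrite -negb_forall; apply/negP => /forallP H.
  have /mxrankS : (A <= v)%MS by apply/row_subP.
  by rewrite rkv (eqP freeA).
have sub : (span2 (row i A) v <= A)%MS by rewrite span2_sub row_sub.
exists (row i A); first exact: row_sub.
apply/eqmx_sym/eqmxP; rewrite -(geq_leqif (mxrank_leqif_eq sub)) (eqP freeA).
have : (v < span2 (row i A) v)%MS.
  rewrite /ltmx; apply/andP; split.
    by apply/sub_span2P; exists 0, 1; rewrite scale0r add0r scale1r.
  by apply: contra iNv; rewrite span2_sub => /andP[].
by rewrite ltmxErank rkv => /andP[].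
Qed.

Lemma span2_shear u v A c : (A :=: span2 u v)%MS -> (A :=: span2 (u - c *: v) v)%MS.
Proof.
move=> eA; apply/eqmxP; rewrite !eA !span2_sub.
have vin w : (v <= span2 w v)%MS.
  by apply/sub_span2P; exists 0, 1; rewrite scale0r add0r scale1r.
rewrite !vin !andbT; apply/andP; split; apply/sub_span2P.
  by exists 1, c; rewrite scale1r subrK.
by exists 1, (- c); rewrite scale1r scaleNr.
Qed.

Lemma span2_scalel a u v A : a != 0 -> (A :=: span2 u v)%MS ->
  (A :=: span2 (a *: u) v)%MS.
Proof.
move=> a0 eA; apply/eqmxP; rewrite !eA !span2_sub.
apply/andP; split; apply/andP; split; apply/sub_span2P.
- by exists a^-1, 0; rewrite scalerA mulVf // scale1r scale0r addr0.
- by exists 0, 1; rewrite scale0r add0r scale1r.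
- by exists a, 0; rewrite scale0r addr0.
- by exists 0, 1; rewrite scale0r add0r scale1r.
Qed.

Definition graph_line (a b c d : E) := span2 (vec4 1 0 a c) (vec4 0 1 b d).
Definition meeting_line (t c : E) := span2 (vec4 (t ^+ 2) 1 c 0) (vec4 0 0 t 1).
Definition axis_line := span2 (vec4 0 0 1 0) (vec4 0 0 0 1).

Lemma line_normal_form A : row_free A ->
  [\/ exists a b c d, (A :=: graph_line a b c d)%MS,
      exists x y c t, (A :=: span2 (vec4 x y c 0) (vec4 0 0 t 1))%MS
    | exists x y c, (A :=: span2 (vec4 x y 0 c) (vec4 0 0 1 0))%MS].
Proof.
move=> freeA; pose A1 : 'M_2 := @lsubmx _ 2 2 2 A.
(* The block of x- and y-coordinates is singular exactly when the line meets x = y = 0; a kernel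
   vector gives the common point. *)
have [/det0P[k k0 kA1] | detA] := boolP (\det A1 == 0); last first.
  have uA : A1 \in unitmx by rewrite unitmxE unitfE.
  pose N := invmx A1 *m A.
  have AN : (A :=: N)%MS.
    apply/eqmx_sym/eqmxP/eqmxMunitP.
    by exists (invmx A1); rewrite ?unitmx_inv.
  have N1 : @lsubmx _ 2 2 2 N = 1%:M by rewrite -(mulVmx uA) -mulmx_lsub.
  have NE i j : N i (@lshift 2 2 j : 'I_4) = (i == j)%:R.
    by have /matrixP/(_ i j) := N1; rewrite !mxE.
  have xE : x_ = @lshift 2 2 (0 : 'I_2) by exact: val_inj.
  have yE : y_ = @lshift 2 2 (1 : 'I_2) by exact: val_inj.
  constructor 1; exists (N 0 z_), (N 1 z_), (N 0 w_), (N 1 w_).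
  apply: eqmx_trans AN _.
  suff <- : N = graph_line (N 0 z_) (N 1 z_) (N 0 w_) (N 1 w_) by exact: eqmx_refl.
  apply/row_matrixP => i; rewrite rowK.
  have [-> | ->] : i = 0 \/ i = 1.
    by case: i => -[|[|//]] lt_i2; [left | right]; exact: val_inj.
  - by apply: eq_vec4; rewrite ?vec4E mxE // ?xE ?yE NE.
  - by apply: eq_vec4; rewrite ?vec4E mxE // ?xE ?yE NE.
pose v := k *m A.
have vA : (v <= A)%MS by exact: submxMl.
have v0 : v != 0.
  apply: contraNneq k0 => kA0; apply/eqP/(row_free_inj freeA).
  by rewrite mul0mx.
have vl : @lsubmx _ 1 2 2 v = 0 by rewrite -mulmx_lsub.
have vx : v 0 x_ = 0.
  have /rowP/(_ 0) := vl; rewrite [LHS]mxE [RHS]mxE => <-; congr (v _ _); exact: val_inj.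
have vy : v 0 y_ = 0.
  have /rowP/(_ 1) := vl; rewrite [LHS]mxE [RHS]mxE => <-; congr (v _ _); exact: val_inj.
clearbody v; have [vw | vw] := eqVneq (v 0 w_) 0.
  have vz : v 0 z_ != 0.
    by apply: contraNneq v0 => vz; apply/eqP/eq_vec4; rewrite ?vx ?vy ?vz ?vw mxE.
  have [||u uA eA] := complete_span2 (v := (v 0 z_)^-1 *: v) freeA.
  - exact: scalemx_sub.
  - by rewrite scaler_eq0 invr_eq0 negb_or vz.
  constructor 3; exists (u 0 x_), (u 0 y_), (u 0 w_).
  have {}eA := span2_shear (u 0 z_) eA; apply: eqmx_trans eA _.
  set u' := (u - _); set v' := _^-1 *: v.
  have -> : v' = vec4 0 0 1 0.
    by apply: eq_vec4; rewrite vec4E mxE ?vx ?vy ?vw ?mulr0 // mulVf.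
  have -> // : u' = vec4 (u 0 x_) (u 0 y_) 0 (u 0 w_).
  by apply: eq_vec4; rewrite vec4E !mxE ?vx ?vy ?vw ?mulr0 ?subr0 // mulVf // mulr1 subrr.
have [||u uA eA] := complete_span2 (v := (v 0 w_)^-1 *: v) freeA.
- exact: scalemx_sub.
- by rewrite scaler_eq0 invr_eq0 negb_or vw.
have {}eA := span2_shear (u 0 w_) eA.
move: eA; set u' := (u - _); set v' := _^-1 *: v => eA.
constructor 2; exists (u' 0 x_), (u' 0 y_), (u' 0 z_), (v' 0 z_).
apply: eqmx_trans eA _.
have u'w : u' 0 w_ = 0 by rewrite !mxE mulVf // mulr1 subrr.
have <- // : v' = vec4 0 0 (v' 0 z_) 1.
  by apply: eq_vec4; rewrite vec4E // !mxE ?vx ?vy ?mulr0 // mulVf.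
by have <- // : u' = vec4 (u' 0 x_) (u' 0 y_) (u' 0 z_) 0; apply: eq_vec4; rewrite vec4E.
Qed.

Lemma sub_axis_line a b c d : (vec4 a b c d <= axis_line)%MS -> a = 0 /\ b = 0.
Proof.
move=> /sub_span2P[s [t /rowP e]]; have := (e x_, e y_); rewrite !mxE /=.
by rewrite !mulr0 addr0 => -[-> ->].
Qed.

Lemma sub_meeting_line t k a b c d : (vec4 a b c d <= meeting_line t k)%MS ->
  a = t ^+ 2 * b /\ c = k * b + t * d.
Proof.
move=> /sub_span2P[s [r /rowP e]]; have := (e x_, e y_, e z_, e w_); rewrite !mxE /=.
by rewrite !mulr0 !mulr1 !addr0 add0r => -[[[-> ->] ->] ->]; split; ring.
Qed.

Lemma sub_graph_line a' b' c' d' a b c d :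
  (vec4 a b c d <= graph_line a' b' c' d')%MS -> c = a' * a + b' * b /\ d = c' * a + d' * b.
Proof.
move=> /sub_span2P[s [r /rowP e]]; have := (e x_, e y_, e z_, e w_); rewrite !mxE /=.
by rewrite !mulr0 !mulr1 !addr0 !add0r => -[[[-> ->] ->] ->]; split; ring.
Qed.

Lemma row_free_graph_line a b c d : row_free (graph_line a b c d).
Proof.
apply: row_free_span2 => s t /rowP e; have := (e x_, e y_); rewrite !mxE /=.
by rewrite !mulr0 !mulr1 addr0 add0r => -[-> ->].
Qed.

Lemma row_free_meeting_line t c : row_free (meeting_line t c).
Proof.
apply: row_free_span2 => s r /rowP e; have := (e y_, e w_); rewrite !mxE /=.
by rewrite !mulr0 !mulr1 addr0 add0r => -[-> ->].
Qed.

Lemma row_free_axis_line : row_free axis_line.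
Proof.
apply: row_free_span2 => s r /rowP e; have := (e z_, e w_); rewrite !mxE /=.
by rewrite !mulr0 !mulr1 addr0 add0r => -[-> ->].
Qed.

Definition standard_line (l : unit + (E * E) + (E * E * E * E)) : 'M[E]_(2, 4) :=
  match l with
  | inl (inl _) => axis_line
  | inl (inr (t, c)) => meeting_line t c
  | inr (a, b, c, d) => graph_line a b c d
  end.

Lemma row_free_standard_line l : row_free (standard_line l).
Proof.
case: l => [[_ | [t c]] | [[[a b] c] d]] /=.
- exact: row_free_axis_line.
- exact: row_free_meeting_line.
- exact: row_free_graph_line.
Qed.

Lemma standard_line_inj l l' :
  (standard_line l :=: standard_line l')%MS -> l = l'.
Proof.
have in1 u v : (u <= span2 u v)%MS.
  by apply/sub_span2P; exists 1, 0; rewrite scale0r addr0 scale1r.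
have in2 u v : (v <= span2 u v)%MS.
  by apply/sub_span2P; exists 0, 1; rewrite scale0r add0r scale1r.
have one0 : (1 : E) <> 0 by apply/eqP; rewrite oner_eq0.
(* By symmetry, only the pairs ordered as axis, meeting line, graph line have to be compared. *)
wlog: l l' / match l, l' with
    | inl (inr _), inl (inl _) | inr _, inl _ => False
    | _, _ => True end.
  move=> H eq_l; move: (H l l') (H l' l).
  case: l l' eq_l => [[?|?]|?] [[?|?]|?] eq_l //= H1 H2; try exact: H1;
    by apply/esym/H2 => //; exact: eqmx_sym.
case: l l' => [[[]|[t c]]|[[[a b] c] d]] [[[]|[t' c']]|[[[a' b'] c'] d']] //= _ eA.
- have : (vec4 (t' ^+ 2) 1 c' 0 <= axis_line)%MS by rewrite eA in1.
  by case/sub_axis_line=> _ /one0.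
- have : (vec4 1 0 a' c' <= axis_line)%MS by rewrite eA in1.
  by case/sub_axis_line=> /one0.
- have : (vec4 0 0 t 1 <= meeting_line t' c')%MS by rewrite -eA in2.
  case/sub_meeting_line=> _; rewrite mulr0 add0r mulr1 => ->.
  have : (vec4 (t ^+ 2) 1 c 0 <= meeting_line t' c')%MS by rewrite -eA in1.
  by case/sub_meeting_line=> _; rewrite mulr0 addr0 mulr1 => ->.
- have : (vec4 1 0 a' c' <= meeting_line t c)%MS by rewrite eA in1.
  by case/sub_meeting_line; rewrite mulr0 => /one0.
have : (vec4 1 0 a c <= graph_line a' b' c' d')%MS by rewrite -eA in1.
case/sub_graph_line; rewrite !mulr0 !mulr1 !addr0 => -> ->.
have : (vec4 0 1 b d <= graph_line a' b' c' d')%MS by rewrite -eA in2.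
by case/sub_graph_line; rewrite !mulr0 !mulr1 !add0r => -> ->.
Qed.

End Lines.

(** * The cubic surface of a quintic *)

Section QuinticForm.

Variable E : fieldType.
Implicit Types (x y z w a b c d s t : E).

Variables h4 h3 h2 h1 h0 : E.

(* In P^1 x P^1, with coordinates (x : y) and (z : w), the (1, 2)-part         *)
(* x w^2 - y z^2 vanishes at the points ((t^2 : 1), (t : 1)), at which the     *)
(* (2, 1)-part takes the value h(t).                                           *)
Definition quintic_form x y z w : E :=
  x ^+ 2 * z + h4 * (x ^+ 2 * w) + h3 * (x * y * z) + h2 * (x * y * w)
  + h1 * (y ^+ 2 * z) + h0 * (y ^+ 2 * w) + x * w ^+ 2 - y * z ^+ 2.

Definition quintic_at t : E :=
  t ^+ 5 + h4 * t ^+ 4 + h3 * t ^+ 3 + h2 * t ^+ 2 + h1 * t + h0.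

(** The difference h(t) - t * [odd_part_at t] is even in t, whence h(-t) = h(t) - 2 t *
    [odd_part_at t]. *)
Definition odd_part_at t : E := t ^+ 4 + h3 * t ^+ 2 + h1.

(** The coefficients of the form along [meeting_line t c], as computed in [quintic_form_meeting];
    [graph_equations] comes from [quintic_form_graph] in the same way. *)
Definition meeting_equations t c : Prop :=
  quintic_at t = 2%:R * c * t /\ c * (odd_part_at t - c) = 0.

Definition graph_equations a b c d : Prop :=
  [/\ a + h4 * c + c ^+ 2 = 0,
      b + h4 * d + h3 * a + h2 * c + 2%:R * c * d - a ^+ 2 = 0,
      h3 * b + h2 * d + h1 * a + h0 * c + d ^+ 2 - 2%:R * a * b = 0
    & h1 * b + h0 * d - b ^+ 2 = 0].

Lemma quintic_form_meeting t c s r :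
  quintic_form (s * t ^+ 2) s (s * c + r * t) r =
  s ^+ 3 * (c * (odd_part_at t - c)) + s ^+ 2 * r * (quintic_at t - 2%:R * c * t).
Proof. by rewrite /quintic_form /odd_part_at /quintic_at; ring. Qed.

Lemma quintic_form_graph a b c d s t :
  quintic_form s t (a * s + b * t) (c * s + d * t) =
  (a + h4 * c + c ^+ 2) * s ^+ 3
  + (b + h4 * d + h3 * a + h2 * c + 2%:R * c * d - a ^+ 2) * (s ^+ 2 * t)
  + (h3 * b + h2 * d + h1 * a + h0 * c + d ^+ 2 - 2%:R * a * b) * (s * t ^+ 2)
  + (h1 * b + h0 * d - b ^+ 2) * t ^+ 3.
Proof. by rewrite /quintic_form; ring. Qed.

(* The line u -> (u, l(u) (t, 1)), l a linear form, for a root t of h. *)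
Definition rank1_graph t : E * E * E * E :=
  let c := - (t + h4) in let d := t ^+ 2 * c - h2 - t * h3 in
  (t * c, t * d, c, d).

(* With (a, b) = ab, the line attached to a factorisation of h as               *)
(* (X^2 + a X + b) (X^3 + c2 X^2 + c1 X + c0): up to a scalar, it is the graph  *)
(* of the homography that maps (t^2 : 1) to (t : 1) for the three roots t of    *)
(* the second factor.                                                           *)
Definition quad_graph (ab : E * E) : E * E * E * E :=
  let c2 := h4 - ab.1 in let c1 := h3 - ab.2 - ab.1 * c2 in
  let c0 := h2 - ab.2 * c2 - ab.1 * c1 in
  (ab.1 * c2, ab.1 * c0, - ab.1, - (ab.1 * c1)).

(** The c_i are the coefficients of the quotient of h by X^2 + a X + b, and the two equations say
    that the remainder is zero. *)
Definition quad_divides a b : Prop :=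
  let c2 := h4 - a in let c1 := h3 - b - a * c2 in
  let c0 := h2 - b * c2 - a * c1 in
  h1 = a * c0 + b * c1 /\ h0 = b * c0.

Lemma rank1_graph_equations t : quintic_at t = 0 ->
  let: (a, b, c, d) := rank1_graph t in graph_equations a b c d.
Proof.
move=> ht; have h0E :
    h0 = - (t ^+ 5 + h4 * t ^+ 4 + h3 * t ^+ 3 + h2 * t ^+ 2 + h1 * t).
  by apply/eqP; rewrite -addr_eq0 addrC -[X in X == 0]/(quintic_at t) ht.
by rewrite /rank1_graph /graph_equations h0E; split; ring.
Qed.

Lemma quad_graph_equations u v : quad_divides u v ->
  let: (a, b, c, d) := quad_graph (u, v) in graph_equations a b c d.
Proof.
rewrite /quad_divides /quad_graph /graph_equations /=.
set c2 := h4 - u; set c1 := h3 - v - u * c2; set c0 := h2 - v * c2 - u * c1.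
have h4E : h4 = c2 + u by rewrite /c2; ring.
have h3E : h3 = c1 + u * c2 + v by rewrite /c1; ring.
have h2E : h2 = c0 + u * c1 + v * c2 by rewrite /c0; ring.
move: h4E h3E h2E; move: c2 c1 c0 => c2 c1 c0 -> -> -> [-> ->].
by split; ring.
Qed.

(** The three outcomes are the possible ranks of the linear map with matrix entries a, b, c, d. *)
Lemma graph_equations_solve a b c d : graph_equations a b c d ->
  [\/ (a, b, c, d) = (0, 0, 0, 0),
      exists2 t, quintic_at t = 0 & (a, b, c, d) = rank1_graph t
    | exists2 uv, quad_divides uv.1 uv.2 & (a, b, c, d) = quad_graph uv].
Proof.
case=> E1 E2 E3 E4; have [det0|det0] := eqVneq (a * d - b * c) 0.
  have [cd0 | cd0] := boolP ((c == 0) && (d == 0)).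
    have [/eqP c0 /eqP d0] := andP cd0; constructor 1.
    have a0 : a = 0 by rewrite -E1 c0; ring.
    have b0 : b = 0 by rewrite -E2 c0 d0 a0; ring.
    by rewrite a0 b0 c0 d0.
  have [t [at_ bt]] : exists t, a = t * c /\ b = t * d.
    have [c0 | c0] := eqVneq c 0.
      have d0 : d != 0 by move: cd0; rewrite c0 eqxx.
      exists (b / d); rewrite c0 mulr0 divfK //; split=> //.
      by apply: (mulIf d0); rewrite mul0r -det0 c0; ring.
    exists (a / c); rewrite divfK //; split=> //.
    apply: (mulIf c0); rewrite mulrAC divfK //.
    by apply/eqP; rewrite eq_sym -subr_eq0 det0.
  subst a b.
  (* On the plane z = t w the form is divisible by w; with w = c x + d y it becomes (c x + d y)(A2
     x^2 + A1 x y + A0 y^2), so the second factor must vanish. *)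
  pose A2 := h4 + t + c; pose A1 := h2 + t * h3 + d - t ^+ 2 * c.
  pose A0 := h0 + t * h1 - t ^+ 2 * d.
  have F1 : c * A2 = 0 by rewrite -E1 /A2; ring.
  have F2 : c * A1 + d * A2 = 0 by rewrite -E2 /A1 /A2; ring.
  have F3 : c * A0 + d * A1 = 0 by rewrite -E3 /A0 /A1; ring.
  have F4 : d * A0 = 0 by rewrite -E4 /A0; ring.
  have [A20 A10 A00] : [/\ A2 = 0, A1 = 0 & A0 = 0].
    have [c0 | c0] := eqVneq c 0.
      have d0 : d != 0 by move: cd0; rewrite c0 eqxx.
      split; apply: (mulfI d0); rewrite mulr0 //.
        by rewrite -F2 c0; ring.
      by rewrite -F3 c0; ring.
    have A20 : A2 = 0 by apply: (mulfI c0); rewrite mulr0.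
    have A10 : A1 = 0 by apply: (mulfI c0); rewrite mulr0 -F2 A20; ring.
    by split=> //; apply: (mulfI c0); rewrite mulr0 -F3 A10; ring.
  constructor 2; exists t.
    have -> : quintic_at t = A0 + t ^+ 2 * A1 + t ^+ 4 * A2.
      by rewrite /quintic_at /A0 /A1 /A2; ring.
    by rewrite A20 A10 A00; ring.
  have cE : c = - (t + h4) by rewrite -[LHS]subr0 -A20 /A2; ring.
  have dE : d = t ^+ 2 * c - h2 - t * h3 by rewrite -[LHS]subr0 -A10 /A1; ring.
  by rewrite /rank1_graph -cE -dE.
have c0 : c != 0.
  apply: contraNneq det0 => c0; have a0 : a = 0 by rewrite -E1 c0; ring.
  by rewrite a0 c0; apply/eqP; ring.
constructor 3.
(* The homography sends (t^2 : 1) to (t : 1) when c t^3 - a t^2 + d t - b = 0; dividing by c gives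
   the cubic factor. *)
pose u := - c; pose c2 := - a / c; pose c1 := d / c; pose e0 := - b / c.
pose v := h3 - c1 - u * c2.
have h4E : h4 = c2 + u.
  by apply: (mulIf c0); rewrite -[LHS]subr0 -E1 /c2 /u; field.
have h3E : h3 = c1 + u * c2 + v by rewrite /v; ring.
have h2E : h2 = e0 + u * c1 + v * c2.
  by apply: (mulIf c0); rewrite -[LHS]subr0 -E2 h4E h3E /e0 /v h3E /c2 /c1 /u; field.
(* The coefficients of the remainder satisfy a homogeneous linear system of nonzero determinant a d
   - b c. *)
have K1 : (h1 - (u * e0 + v * c1)) * a + (h0 - v * e0) * c = 0.
  by rewrite -E3 h2E h3E /e0 /c2 /c1 /u; field.
have K2 : (h1 - (u * e0 + v * c1)) * b + (h0 - v * e0) * d = 0.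
  by rewrite -E4 /e0 /c1 /u; field.
have h1E : h1 = u * e0 + v * c1.
  apply/eqP; rewrite -subr_eq0; apply/eqP/(mulIf det0); rewrite mul0r.
  transitivity (((h1 - (u * e0 + v * c1)) * a + (h0 - v * e0) * c) * d -
    ((h1 - (u * e0 + v * c1)) * b + (h0 - v * e0) * d) * c); first by ring.
  by rewrite K1 K2; ring.
have h0E : h0 = v * e0.
  apply/eqP; rewrite -subr_eq0; apply/eqP/(mulIf c0).
  by move: K1; rewrite h1E subrr mul0r add0r mul0r.
have c2E : h4 - u = c2 by rewrite h4E; ring.
have c1E : h3 - v - u * c2 = c1 by rewrite /v; ring.
have e0E : h2 - v * c2 - u * c1 = e0 by rewrite h2E; ring.
exists (u, v); rewrite /quad_divides /quad_graph /= c2E c1E e0E //.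
by rewrite /u /c2 /c1 /e0; congr (_, _, _, _); field.
Qed.

End QuinticForm.

(** * The lines of a quintic without opposite roots *)

Section QuinticSurface.

Variables (K : fieldType) (h : {poly K}).
Hypotheses (h_monic : h \is monic) (size_h : size h = 6).
Hypothesis h_reflect : coprimep h (h \Po - 'X).

Local Notation h_at := (quintic_at h`_4 h`_3 h`_2 h`_1 h`_0).
Local Notation odd_at := (odd_part_at h`_3 h`_1).
Local Notation h_divides := (quad_divides h`_4 h`_3 h`_2 h`_1 h`_0).
Local Notation h_rank1 := (rank1_graph h`_4 h`_3 h`_2).
Local Notation h_quad := (quad_graph h`_4 h`_3 h`_2).

Lemma quintic_lead : h`_5 = 1.
Proof. by have /monicP := h_monic; rewrite lead_coefE size_h. Qed.

Lemma quintic_poly : h = 'X^5 + (h`_4)%:P * 'X^4 + (h`_3)%:P * 'X^3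
  + (h`_2)%:P * 'X^2 + (h`_1)%:P * 'X + (h`_0)%:P.
Proof.
rewrite -[LHS]coefK poly_def size_h !big_ord_recr big_ord0 /= quintic_lead.
by rewrite -!mul_polyC expr0 expr1; ring.
Qed.

Lemma horner_quintic t : h.[t] = h_at t.
Proof. by rewrite {1}quintic_poly !(hornerD, hornerM, hornerC, hornerXn, hornerX). Qed.

Lemma quad_dividesP u v : h_divides u v <-> (quad u v %| h).
Proof.
split.
  rewrite /quad_divides; set c2 := _ - u; set c1 := _ - u * c2.
  set c0 := _ - u * c1 => -[h1E h0E].
  have h4E : h`_4 = c2 + u by rewrite /c2; ring.
  have h3E : h`_3 = c1 + u * c2 + v by rewrite /c1; ring.
  have h2E : h`_2 = c0 + u * c1 + v * c2 by rewrite /c0; ring.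
  apply/dvdpP; exists ('X^3 + c2%:P * 'X^2 + c1%:P * 'X + c0%:P).
  rewrite [LHS]quintic_poly h4E h3E h2E h1E h0E quadE.
  by rewrite !(rmorphD, rmorphM) /=; ring.
move=> /dvdpP[q hE].
have q0 : q != 0 by apply: contra_eqN size_h => /eqP q0; rewrite hE q0 mul0r size_poly0.
have size_q : size q = 4.
  move: size_h; rewrite hE (size_mul q0 (monic_neq0 (quad_monic u v))) size_quad.
  by rewrite addn3 => -[].
have coef_h i : h`_i = (if (i < 2)%N then 0 else q`_(i - 2))
    + u * (if i == 0 then 0 else q`_i.-1) + v * q`_i.
  rewrite {1}hE /quad !mulrDr coefD coefMC coefD coefMXn [q`_i * v]mulrC.
  congr (_ + _ + _).
  by rewrite -scalerAr coefZ coefMX.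
have q5 : q`_5 = 0 by rewrite nth_default ?size_q.
have q4 : q`_4 = 0 by rewrite nth_default ?size_q.
have h5E : 1 = q`_3 + u * q`_4 + v * q`_5 by rewrite -quintic_lead coef_h.
have h4E : h`_4 = q`_2 + u * q`_3 + v * q`_4 := coef_h 4.
have h3E : h`_3 = q`_1 + u * q`_2 + v * q`_3 := coef_h 3.
have h2E : h`_2 = q`_0 + u * q`_1 + v * q`_2 := coef_h 2.
have h1E : h`_1 = 0 + u * q`_0 + v * q`_1 := coef_h 1.
have h0E : h`_0 = 0 + u * 0 + v * q`_0 := coef_h 0.
have q3 : q`_3 = 1 by rewrite h5E q4 q5; ring.
rewrite /quad_divides h4E h3E h2E h1E h0E q3 q4.
by move: (q`_2) (q`_1) (q`_0) => c2 c1 c0; split; ring.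
Qed.

(** An even divisor of h also divides h(- X). Degenerate parameters are excluded by exhibiting such
    a divisor. *)
Lemma quintic_even_divisor (g : {poly K}) : (1 < size g)%N -> g \Po - 'X = g -> ~~ (g %| h).
Proof.
move=> g1 even_g; apply/negP => gh.
have gh' : g %| h \Po - 'X by rewrite -even_g dvdp_comp_poly.
have /coprimepP/(_ g gh gh') := h_reflect.
by rewrite -size_poly_eq1 => /eqP g1'; rewrite g1' in g1.
Qed.

Lemma quintic_root_opp t : h_at t = 0 -> h_at (- t) != 0.
Proof.
rewrite -!horner_quintic => /eqP ht.
by have := coprimep_root h_reflect ht; rewrite horner_comp hornerN hornerX.
Qed.

Lemma odd_part_neq0 t : h_at t = 0 -> odd_at t != 0.
Proof.
move=> ht; apply: contraNneq (quintic_root_opp ht) => o0; apply/eqP.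
transitivity (h_at t - 2%:R * t * odd_at t).
  by rewrite /quintic_at /odd_part_at; ring.
by rewrite ht o0; ring.
Qed.

Lemma quad_even (b : K) : quad 0 b \Po - 'X = quad 0 b.
Proof.
by rewrite quadE !(rmorphD, rmorphM) /= comp_polyX !comp_polyC; ring.
Qed.

(** Otherwise h would be X - t times an even quartic. *)
Lemma rank1_graph_neq0 t : h_at t = 0 -> h_rank1 t <> (0, 0, 0, 0).
Proof.
move=> ht [_ _ c0]; rewrite c0 => d0.
have {}c0 : h`_4 - - t = 0 by apply/eqP; rewrite opprK addrC -oppr_eq0 c0.
have h4E : h`_4 = - t by exact: subr0_eq.
have h2E : h`_2 = - (t * h`_3).
  by apply: oppr_inj; apply: subr0_eq; rewrite -[RHS]d0; ring.
have h0E : h`_0 = - (t * h`_1).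
  by apply: subr0_eq; rewrite -[RHS]ht /quintic_at h4E h2E; ring.
pose g : {poly K} := 'X^4 + (h`_3)%:P * 'X^2 + (h`_1)%:P.
have sg : size g = 5.
  rewrite /g -addrA size_polyDl size_polyXn //.
  rewrite (leq_ltn_trans (size_polyD _ _)) // gtn_max mul_polyC.
  rewrite (leq_ltn_trans (size_scale_leq _ _)) ?size_polyXn //.
  by rewrite (leq_ltn_trans (size_polyC_leq1 _)).
have even_g : g \Po - 'X = g.
  by rewrite /g !(rmorphD, rmorphM, rmorphXn) /= comp_polyX !comp_polyC; ring.
have := quintic_even_divisor (g := g); rewrite sg => /(_ isT even_g)/negP; apply.
apply/dvdpP; exists ('X - t%:P).
rewrite [LHS]quintic_poly h4E h2E h0E /g !(rmorphN, rmorphM) /=; ring.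
Qed.

Lemma quad_divides_neq0 u v : h_divides u v -> u != 0.
Proof.
move=> /quad_dividesP; apply: contraTneq => ->.
by apply: quintic_even_divisor; rewrite ?size_quad ?quad_even.
Qed.

(** The determinant is u^2 (c0 - c1 c2). If it vanished, the cubic factor would be (X^2 + c1)(X +
    c2), which has an even divisor. *)
Lemma quad_graph_det uv : h_divides uv.1 uv.2 ->
  let: (a, b, c, d) := h_quad uv in a * d != b * c.
Proof.
case: uv => u v /= uv; have u0 := quad_divides_neq0 uv; move: uv.
rewrite /quad_graph /quad_divides /=; set c2 := _ - u; set c1 := _ - u * c2.
set c0 := _ - u * c1 => -[h1E h0E].
have h4E : h`_4 = c2 + u by rewrite /c2; ring.
have h3E : h`_3 = c1 + u * c2 + v by rewrite /c1; ring.
have h2E : h`_2 = c0 + u * c1 + v * c2 by rewrite /c0; ring.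
apply/eqP => e; have c0E : c0 = c1 * c2.
  apply: (mulfI u0); apply: (mulfI u0); apply: subr0_eq.
  by move/eqP: e; rewrite -subr_eq0 => /eqP e; rewrite -[RHS]e; ring.
have := @quintic_even_divisor (quad 0 c1); rewrite size_quad quad_even.
move=> /(_ isT erefl)/negP; apply; apply/dvdpP.
exists (quad u v * ('X + c2%:P)).
rewrite [LHS]quintic_poly h4E h3E h2E h1E h0E c0E !quadE.
by rewrite !(rmorphD, rmorphM) /=; ring.
Qed.

Lemma quad_graph_inj u v u' v' : h_divides u v ->
  h_quad (u, v) = h_quad (u', v') -> (u, v) = (u', v').
Proof.
move=> uv; have u0 := quad_divides_neq0 uv.
rewrite /quad_graph /= => -[_ _ /oppr_inj <-] /oppr_inj/(mulfI u0)/eqP.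
by rewrite (inj_eq (addIr _)) (inj_eq (addrI _)) (inj_eq oppr_inj) => /eqP <-.
Qed.

Variables (rs : seq K) (qs : seq (K * K)).
Hypotheses (rsP : forall t, (t \in rs) = root h t) (uniq_rs : uniq rs).
Hypotheses (qsP : forall u v, ((u, v) \in qs) <-> (quad u v %| h)) (uniq_qs : uniq qs).

Lemma mem_rs t : t \in rs <-> h_at t = 0.
Proof. by rewrite rsP rootE horner_quintic; split=> /eqP. Qed.

Lemma mem_qs u v : (u, v) \in qs <-> h_divides u v.
Proof. by rewrite qsP quad_dividesP. Qed.

Definition meeting_params : seq (K * K) :=
  [seq (t, 0) | t <- rs] ++ [seq (- t, odd_at t) | t <- rs].

Definition graph_params : seq (K * K * K * K) :=
  (0, 0, 0, 0) :: [seq h_rank1 t | t <- rs] ++ [seq h_quad uv | uv <- qs].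

(** Either c = 0 and t is a root of h, or c is the odd part at t and the first equation becomes
    h(-t) = 0. *)
Lemma meeting_paramsP t c :
  (t, c) \in meeting_params <-> meeting_equations h`_4 h`_3 h`_2 h`_1 h`_0 t c.
Proof.
have opp s : h_at (- s) = h_at s - 2%:R * s * odd_at s.
  by rewrite /quintic_at /odd_part_at; ring.
have oddN s : odd_at (- s) = odd_at s by rewrite /odd_part_at; ring.
rewrite mem_cat /meeting_equations; split.
  case/orP=> /mapP[s /mem_rs hs [-> ->]]; first by rewrite hs; split; ring.
  by rewrite oddN opp hs; split; ring.
case=> ht /eqP; rewrite mulf_eq0 => /orP[/eqP c0 | ].
  by rewrite c0 map_f //; apply/mem_rs; rewrite ht c0; ring.
rewrite subr_eq0 => /eqP cE; apply/orP; right; apply/mapP; exists (- t).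
  by apply/mem_rs; rewrite opp ht -cE; ring.
by rewrite oddN opprK cE.
Qed.

Lemma graph_paramsP a b c d : (a, b, c, d) \in graph_params <->
  graph_equations h`_4 h`_3 h`_2 h`_1 h`_0 a b c d.
Proof.
split.
  rewrite inE mem_cat; case/or3P=> [/eqP[-> -> -> ->] | /mapP[t + e] | /mapP[[u v] + e]].
  - by split; ring.
  - by move=> /mem_rs/rank1_graph_equations; rewrite -e.
  - by move=> /mem_qs/quad_graph_equations; rewrite -e.
have H l : [\/ l = (0, 0, 0, 0), exists2 t, h_at t = 0 & l = h_rank1 t
    | exists2 uv, h_divides uv.1 uv.2 & l = h_quad uv] -> l \in graph_params.
  case=> [-> | [t ht ->] | [[u v] uv ->]]; first exact: mem_head.
    by rewrite inE mem_cat map_f ?orbT //; apply/mem_rs.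
  by rewrite inE mem_cat [X in _ || (_ || X)]map_f ?orbT //; apply/mem_qs.
by move=> /graph_equations_solve/H.
Qed.

Lemma uniq_meeting_params : uniq meeting_params.
Proof.
rewrite cat_uniq !map_inj_uniq ?uniq_rs //=; first last.
- by move=> t s [].
- by move=> t s [/oppr_inj].
rewrite andbT; apply/hasPn => _ /mapP[t /mem_rs /odd_part_neq0 /eqP ot ->].
by apply/negP => /mapP[s _ [_ /ot]].
Qed.

(** The rank separates the three families; among the rank 1 maps, the entry c determines t. *)
Lemma uniq_graph_params : uniq graph_params.
Proof.
rewrite /= cat_uniq mem_cat negb_or; apply/and4P; split.
- apply/andP; split; apply/negP.
    by case/mapP=> t /mem_rs/rank1_graph_neq0 t0 /esym/t0.
  case/mapP=> -[u v] /mem_qs uv e; have := quad_graph_det (uv := (u, v)) uv.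
  by rewrite -e mulr0 eqxx.
- rewrite map_inj_uniq // => t s [_ _ /oppr_inj/addIr //].
- apply/hasPn => _ /mapP[[u v] /mem_qs uv ->].
  apply/negP => /mapP[t _ e]; have := quad_graph_det (uv := (u, v)) uv.
  by rewrite e => /eqP; apply; ring.
- rewrite map_inj_in_uniq // => -[u v] [u' v'] /mem_qs uv _.
  exact: quad_graph_inj.
Qed.

End QuinticSurface.

(** * Smoothness of the quintic surface *)

Section QuinticSmooth.

Variables (L : closedFieldType) (h : {poly L}).
Hypotheses (h_monic : h \is monic) (size_h : size h = 6).
Hypotheses (h_sep : coprimep h h^`()) (h_reflect : coprimep h (h \Po - 'X)).
Hypothesis three_neq0 : 3%:R != 0 :> L.

Lemma horner_quintic_deriv t : h^`().[t] = 5%:R * t ^+ 4 + 4%:R * h`_4 * t ^+ 3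
  + 3%:R * h`_3 * t ^+ 2 + 2%:R * h`_2 * t + h`_1.
Proof.
rewrite {1}(quintic_poly h_monic size_h) !mul_polyC !derivD !derivZ !derivXn !derivC derivX.
rewrite !(hornerD, hornerZ, hornerMn, hornerC, hornerXn, hornerX) /=.
by ring.
Qed.

Lemma quintic_form_smooth x y z w :
  2%:R * x * z + 2%:R * h`_4 * (x * w) + h`_3 * (y * z) + h`_2 * (y * w)
    + w ^+ 2 = 0 ->
  h`_3 * (x * z) + h`_2 * (x * w) + 2%:R * h`_1 * (y * z)
    + 2%:R * h`_0 * (y * w) - z ^+ 2 = 0 ->
  x ^+ 2 + h`_3 * (x * y) + h`_1 * y ^+ 2 - 2%:R * y * z = 0 ->
  h`_4 * x ^+ 2 + h`_2 * (x * y) + h`_0 * y ^+ 2 + 2%:R * x * w = 0 ->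
  [/\ x = 0, y = 0, z = 0 & w = 0].
Proof.
move=> Fx Fy Fz Fw.
(* Euler's identity in each of the pairs (x, y) and (z, w) separately. *)
pose f := x ^+ 2 * z + h`_4 * (x ^+ 2 * w) + h`_3 * (x * y * z) + h`_2 * (x * y * w)
  + h`_1 * (y ^+ 2 * z) + h`_0 * (y ^+ 2 * w).
pose g := x * w ^+ 2 - y * z ^+ 2.
have fg1 : 2%:R * f + g = 0.
  have := congr2 +%R (congr1 ( *%R x) Fx) (congr1 ( *%R y) Fy).
  by rewrite !mulr0 addr0 => <-; rewrite /f /g; ring.
have fg2 : f + 2%:R * g = 0.
  have := congr2 +%R (congr1 ( *%R z) Fz) (congr1 ( *%R w) Fw).
  by rewrite !mulr0 addr0 => <-; rewrite /f /g; ring.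
have g0 : g = 0.
  apply: (mulfI three_neq0).
  transitivity (2%:R * (f + 2%:R * g) - (2%:R * f + g)); first by ring.
  by rewrite fg1 fg2; ring.
have f0 : f = 0 by rewrite -fg2 g0; ring.
have opp := quintic_root_opp h_monic size_h h_reflect.
have [y0 | y0] := eqVneq y 0.
  have x0 : x = 0.
    by apply/eqP; rewrite -sqrf_eq0; apply/eqP; rewrite -[RHS]Fz y0; ring.
  split=> //; apply/eqP; rewrite -sqrf_eq0; apply/eqP.
    by apply: oppr_inj; rewrite oppr0 -[RHS]Fy x0 y0; ring.
  by rewrite -[RHS]Fx x0 y0; ring.
exfalso; have [w0 | w0] := eqVneq w 0.
  have z0 : z = 0.
    apply/eqP; rewrite -sqrf_eq0; apply/eqP/(mulfI y0); apply: oppr_inj.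
    by rewrite mulr0 oppr0 -[RHS]g0 /g w0; ring.
  (* On the line z = w = 0, a singular point makes the odd and the even part of h vanish at t, so t
     and - t are both roots. *)
  have [t tE] : exists t, t ^+ 2 = x / y.
    have [t] : exists t, root ('X^2 - (x / y)%:P) t.
      by apply/closed_rootP; rewrite size_XnsubC.
    by rewrite rootE !hornerE subr_eq0 => /eqP; exists t.
  have xE : x = t ^+ 2 * y by rewrite tE divfK.
  have y20 : y ^+ 2 != 0 by rewrite expf_eq0.
  have o0 : t ^+ 4 + h`_3 * t ^+ 2 + h`_1 = 0.
    by apply: (mulfI y20); rewrite mulr0 -[RHS]Fz z0 xE; ring.
  have e0 : h`_4 * t ^+ 4 + h`_2 * t ^+ 2 + h`_0 = 0.
    by apply: (mulfI y20); rewrite mulr0 -[RHS]Fw w0 xE; ring.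
  have ht : quintic_at h`_4 h`_3 h`_2 h`_1 h`_0 t = 0.
    transitivity (t * (t ^+ 4 + h`_3 * t ^+ 2 + h`_1)
      + (h`_4 * t ^+ 4 + h`_2 * t ^+ 2 + h`_0)); first by rewrite /quintic_at; ring.
    by rewrite o0 e0; ring.
  have /eqP := opp t ht; apply.
  transitivity (- t * (t ^+ 4 + h`_3 * t ^+ 2 + h`_1)
    + (h`_4 * t ^+ 4 + h`_2 * t ^+ 2 + h`_0)); first by rewrite /quintic_at; ring.
  by rewrite o0 e0; ring.
(* Here g = 0 and f = 0 put the point over a root t of h, and the partials in x and z combine to
   h'(t) = 0. *)
pose t := z / w; have zE : z = t * w by rewrite divfK.
have w20 : w ^+ 2 != 0 by rewrite expf_eq0.
have xE : x = t ^+ 2 * y.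
  apply: (mulfI w20); apply: subr0_eq; rewrite -[RHS]g0 /g zE; ring.
have y2w0 : y ^+ 2 * w != 0 by rewrite mulf_neq0 ?expf_eq0.
have ht : quintic_at h`_4 h`_3 h`_2 h`_1 h`_0 t = 0.
  by apply: (mulfI y2w0); rewrite mulr0 -[RHS]f0 /f /quintic_at xE zE; ring.
have rt : root h t by rewrite rootE horner_quintic ?ht.
have /eqP := coprimep_root h_sep rt; apply; rewrite horner_quintic_deriv.
apply: (mulfI (mulf_neq0 y0 y0)).
pose D := 2%:R * t ^+ 2 * (t + h`_4) + h`_3 * t + h`_2.
have yD : y * D + w = 0.
  by apply: (mulfI w0); rewrite mulr0 -[RHS]Fx xE zE /D; ring.
have yO : y * (t ^+ 4 + h`_3 * t ^+ 2 + h`_1) - 2%:R * t * w = 0.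
  by apply: (mulfI y0); rewrite mulr0 -[RHS]Fz xE zE; ring.
transitivity (y * ((y * (t ^+ 4 + h`_3 * t ^+ 2 + h`_1) - 2%:R * t * w)
  + 2%:R * t * (y * D + w))).
  by rewrite /D; ring.
by rewrite yO yD; ring.
Qed.

End QuinticSmooth.

(** The values at (1, 0), (0, 1), (1, 1) and (1, -1) already determine a binary cubic form when 2 is
    invertible. *)
Lemma cubic_coefs_eq0 (K : fieldType) (a b c d : K) : 2%:R != 0 :> K ->
  (forall s t, a * s ^+ 3 + b * (s ^+ 2 * t) + c * (s * t ^+ 2) + d * t ^+ 3 = 0) ->
  [/\ a = 0, b = 0, c = 0 & d = 0].
Proof.
move=> two0 H; have a0 : a = 0 by rewrite -[RHS](H 1 0); ring.
have d0 : d = 0 by rewrite -[RHS](H 0 1); ring.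
have bc : b + c = 0 by rewrite -[RHS](H 1 1) a0 d0; ring.
have cb : c - b = 0 by rewrite -[RHS](H 1 (-1)) a0 d0; ring.
have c0 : c = 0.
  apply: (mulfI two0); transitivity ((b + c) + (c - b)); first by ring.
  by rewrite bc cb; ring.
by split=> //; rewrite -bc c0; ring.
Qed.

Definition quintic_surface (K : fieldType) (h : {poly K}) : {mpoly K[4]} :=
  cubic_term 1 x_ x_ z_ + cubic_term h`_4 x_ x_ w_ + cubic_term h`_3 x_ y_ z_
  + cubic_term h`_2 x_ y_ w_ + cubic_term h`_1 y_ y_ z_ + cubic_term h`_0 y_ y_ w_
  + cubic_term 1 x_ w_ w_ + cubic_term (-1) y_ z_ z_.

Lemma quintic_surface_homog (K : fieldType) (h : {poly K}) :
  quintic_surface h \is 3.-homog.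
Proof. by rewrite !rpredD ?cubic_term_homog. Qed.

Section QuinticLines.

Variables (K : fieldType) (L : closedFieldType) (iota : {rmorphism K -> L}).
Hypothesis char0 : forall k, k.+1%:R != 0 :> K.

Variable h : {poly K}.
Hypotheses (h_monic : h \is monic) (size_h : size h = 6).
Hypotheses (h_sep : coprimep h h^`()) (h_reflect : coprimep h (h \Po - 'X)).

Lemma form_eval_quintic_surface v : form_eval iota (quintic_surface h) v =
  quintic_form (iota h`_4) (iota h`_3) (iota h`_2) (iota h`_1) (iota h`_0)
    (v 0 x_) (v 0 y_) (v 0 z_) (v 0 w_).
Proof.
rewrite /quintic_surface !form_evalD !form_eval_cubic_term rmorphN rmorph1.
by rewrite /quintic_form; ring.
Qed.

Lemma form_eval_quintic_surface_map v :
  form_eval iota (quintic_surface h) (map_mx iota v) =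
  iota (quintic_form h`_4 h`_3 h`_2 h`_1 h`_0 (v 0 x_) (v 0 y_) (v 0 z_) (v 0 w_)).
Proof.
rewrite form_eval_quintic_surface /quintic_form !mxE.
by rewrite rmorphB !(rmorphD, rmorphM, rmorphXn).
Qed.

Lemma quintic_surface_smooth : smooth_surface iota (quintic_surface h).
Proof.
move=> v v0 _; apply: contrapT => /forallNP dF.
have dF0 i : form_eval iota (quintic_surface h)^`M(i) v = 0.
  by apply/eqP/negPn/negP; exact: dF.
pose hL := map_poly iota h.
have natL k : (0 < k)%N -> k%:R != 0 :> L.
  by case: k => // k _; rewrite -(rmorph_nat iota) fmorph_eq0.
have [] := @quintic_form_smooth L hL _ _ _ _ (natL 3 isT)
  (v 0 x_) (v 0 y_) (v 0 z_) (v 0 w_).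
- by rewrite map_monic.
- by rewrite size_map_poly.
- by rewrite deriv_map coprimep_map.
- have -> : hL \Po - 'X = map_poly iota (h \Po - 'X).
    by rewrite map_comp_poly rmorphN /= map_polyX.
  by rewrite coprimep_map.
- rewrite !coef_map -[RHS](dF0 x_) /quintic_surface !mderivD !form_evalD.
  by rewrite !form_eval_mderiv_cubic_term /= !(rmorphN, rmorph1); ring.
- rewrite !coef_map -[RHS](dF0 y_) /quintic_surface !mderivD !form_evalD.
  by rewrite !form_eval_mderiv_cubic_term /= !(rmorphN, rmorph1); ring.
- rewrite !coef_map -[RHS](dF0 z_) /quintic_surface !mderivD !form_evalD.
  by rewrite !form_eval_mderiv_cubic_term /= !(rmorphN, rmorph1); ring.
- rewrite !coef_map -[RHS](dF0 w_) /quintic_surface !mderivD !form_evalD.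
  by rewrite !form_eval_mderiv_cubic_term /= !(rmorphN, rmorph1); ring.
move=> vx vy vz vw; case/eqP: v0.
by apply: eq_vec4; rewrite ?vx ?vy ?vz ?vw mxE.
Qed.

End QuinticLines.

(** * Counting the rational lines of the quintic surface *)

Section QuinticLineCount.

Variables (K : fieldType) (L : closedFieldType) (iota : {rmorphism K -> L}).
Hypotheses (algL : algebraic_closure iota) (char0 : forall k, k.+1%:R != 0 :> K).

Variable h : {poly K}.
Hypotheses (h_monic : h \is monic) (size_h : size h = 6).
Hypothesis h_reflect : coprimep h (h \Po - 'X).

Variables (rs : seq K) (qs : seq (K * K)).
Hypotheses (rsP : forall t, (t \in rs) = root h t) (uniq_rs : uniq rs).
Hypotheses (qsP : forall u v, ((u, v) \in qs) <-> (quad u v %| h)) (uniq_qs : uniq qs).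

Local Notation h_form := (quintic_form h`_4 h`_3 h`_2 h`_1 h`_0).
Local Notation hL_form :=
  (quintic_form (iota h`_4) (iota h`_3) (iota h`_2) (iota h`_1) (iota h`_0)).

Definition quintic_params : seq (unit + (K * K) + (K * K * K * K)) :=
  inl (inl tt) :: [seq inl (inr m) | m <- meeting_params h rs]
  ++ [seq inr g | g <- graph_params h rs qs].

Lemma size_quintic_params : size quintic_params = (2 + 3 * size rs + size qs)%N.
Proof. by rewrite /= !(size_cat, size_map) /= !(size_cat, size_map) !mulSn; lia. Qed.

Lemma uniq_quintic_params : uniq quintic_params.
Proof.
rewrite /quintic_params cons_uniq cat_uniq mem_cat negb_or !map_inj_uniq; try by move=> ? ? [].
rewrite uniq_meeting_params // uniq_graph_params // !andbT -andbA.
apply/and3P; split; first by apply/negP => /mapP[].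
  by apply/negP => /mapP[].
by apply/hasPn => _ /mapP[g _ ->]; apply/negP => /mapP[].
Qed.

Lemma meeting_params_inL t c : (t, c) \in meeting_params h rs -> forall s r,
  hL_form (s * iota t ^+ 2) s (s * iota c + r * iota t) r = 0.
Proof.
move=> /(meeting_paramsP h_monic size_h rsP)[E1 E2] s r; rewrite quintic_form_meeting.
have -> : quintic_at (iota h`_4) (iota h`_3) (iota h`_2) (iota h`_1) (iota h`_0)
    (iota t) = iota (quintic_at h`_4 h`_3 h`_2 h`_1 h`_0 t).
  by rewrite /quintic_at !(rmorphD, rmorphM, rmorphXn).
have -> : iota c * (odd_part_at (iota h`_3) (iota h`_1) (iota t) - iota c) =
    iota (c * (odd_part_at h`_3 h`_1 t - c)).
  by rewrite /odd_part_at rmorphM rmorphB !(rmorphD, rmorphM, rmorphXn).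
by rewrite E1 E2 !rmorphM rmorph_nat rmorph0; ring.
Qed.

Lemma graph_params_inL a b c d : (a, b, c, d) \in graph_params h rs qs -> forall s t,
  hL_form s t (s * iota a + t * iota b) (s * iota c + t * iota d) = 0.
Proof.
move=> /(graph_paramsP h_monic size_h rsP qsP)[E1 E2 E3 E4] s t.
rewrite ![s * _]mulrC ![t * _]mulrC quintic_form_graph.
move: (congr1 iota E1) (congr1 iota E2) (congr1 iota E3) (congr1 iota E4).
rewrite rmorph0 !(rmorph_nat iota, rmorphXn iota, rmorphB, rmorphD, rmorphM) => -> -> -> ->.
by ring.
Qed.

Lemma map_span2 (p q : 'rV[K]_4) :
  map_mx iota (span2 p q) = span2 (map_mx iota p) (map_mx iota q).
Proof.
by apply/row_matrixP => i; rewrite -map_row !rowK; case: i => -[|[|//]].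
Qed.

Lemma quintic_params_inL l : l \in quintic_params -> forall u : 'rV[L]_2,
  form_eval iota (quintic_surface h) (u *m map_mx iota (standard_line l)) = 0.
Proof.
move=> sl u; rewrite form_eval_quintic_surface; move: sl.
rewrite inE mem_cat.
case/or3P=> [/eqP-> | /mapP[[t c] tc ->] | /mapP[[[[a b] c] d] abcd ->]] /=.
- rewrite /axis_line map_span2 mul_span2 !mxE /= !(rmorph0, rmorph1).
  by rewrite /quintic_form; ring.
- rewrite /meeting_line map_span2 mul_span2 !mxE /= !(rmorph0, rmorph1, rmorphXn).
  rewrite !(mulr0, mulr1, addr0, add0r); exact: meeting_params_inL.
rewrite /graph_line map_span2 mul_span2 !mxE /= !(rmorph0, rmorph1).
by rewrite !(mulr0, mulr1, addr0, add0r); exact: graph_params_inL.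
Qed.

Lemma eqmx_of_sub_row_free (A B : 'M[K]_(2, 4)) :
  row_free A -> row_free B -> (A <= B)%MS -> (A :=: B)%MS.
Proof.
move=> /eqP rA /eqP rB sAB; apply/eqmxP.
by rewrite -(geq_leqif (mxrank_leqif_eq sAB)) rA rB.
Qed.

Lemma quintic_params_complete (A : 'M[K]_(2, 4)) : row_free A ->
  (forall v : 'rV[K]_4, (v <= A)%MS -> h_form (v 0 x_) (v 0 y_) (v 0 z_) (v 0 w_) = 0) ->
  exists2 l, l \in quintic_params & (A :=: standard_line l)%MS.
Proof.
move=> freeA FA; have two0 : 2%:R != 0 :> K := char0 1.
have on_span u v : (A :=: span2 u v)%MS -> forall s t,
    h_form (s * u 0 x_ + t * v 0 x_) (s * u 0 y_ + t * v 0 y_)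
      (s * u 0 z_ + t * v 0 z_) (s * u 0 w_ + t * v 0 w_) = 0.
  move=> eA s t; have := FA (s *: u + t *: v); rewrite !mxE; apply.
  by rewrite eA; apply/sub_span2P; exists s, t.
have axis :
    (exists c t : K, (A :=: span2 (vec4 0 0 c 0)%R (vec4 0 0 t 1)%R)%MS) \/
    (exists c : K, (A :=: span2 (vec4 0 0 0 c)%R (vec4 0 0 1 0)%R)%MS) ->
    exists2 l, l \in quintic_params & (A :=: standard_line l)%MS.
  move=> eA; exists (inl (inl tt)); first exact: mem_head.
  apply: eqmx_of_sub_row_free => //; first exact: row_free_axis_line.
  have in_axis z w : (vec4 0 0 z w <= @axis_line K)%MS.
    apply/sub_span2P; exists z, w.
    by apply: eq_vec4; rewrite !mxE /= ?mulr0 ?mulr1 ?addr0 ?add0r.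
  by case: eA => [[c [t ->]]|[c ->]]; rewrite span2_sub !in_axis.
have [[a [b [c [d eA]]]] | [x [y [c [t eA]]]] | [x [y [c eA]]]] := line_normal_form freeA.
- exists (inr (a, b, c, d)) => //; rewrite inE mem_cat [X in [|| _, _ | X]]map_f ?orbT //.
  apply/(graph_paramsP h_monic size_h rsP qsP).
  have [|E1 E2 E3 E4] := @cubic_coefs_eq0 K (a + h`_4 * c + c ^+ 2)
    (b + h`_4 * d + h`_3 * a + h`_2 * c + 2%:R * c * d - a ^+ 2)
    (h`_3 * b + h`_2 * d + h`_1 * a + h`_0 * c + d ^+ 2 - 2%:R * a * b)
    (h`_1 * b + h`_0 * d - b ^+ 2) two0.
    move=> s t; rewrite -quintic_form_graph; have := on_span _ _ eA s t.
    by rewrite !mxE /= !(mulr0, mulr1, addr0, add0r) ![s * _]mulrC ![t * _]mulrC.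
  by split.
(* The coefficient of s r^2 forces x = t^2 y; when y = 0 the line is the axis. *)
- have [|_ _ xE _] := @cubic_coefs_eq0 K
    (x ^+ 2 * c + h`_3 * (x * y * c) + h`_1 * (y ^+ 2 * c) - y * c ^+ 2)
    (x ^+ 2 * t + h`_4 * x ^+ 2 + h`_3 * (x * y * t) + h`_2 * (x * y)
      + h`_1 * (y ^+ 2 * t) + h`_0 * y ^+ 2 - 2%:R * y * c * t)
    (x - y * t ^+ 2) 0 two0.
    move=> s r; rewrite -[RHS](on_span _ _ eA s r) !mxE /=.
    by rewrite /quintic_form; ring.
  have {}xE : x = y * t ^+ 2 by exact: subr0_eq.
  have [y0 | y0] := eqVneq y 0.
    by apply: axis; left; exists c, t; rewrite xE y0 mul0r in eA.
  have {}eA : (A :=: meeting_line t (c / y))%MS.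
    rewrite /meeting_line; have -> : vec4 (t ^+ 2) 1 (c / y) 0 = y^-1 *: vec4 x y c 0.
      by apply: eq_vec4; rewrite !mxE /= ?xE; field.
    by apply: span2_scalel => //; rewrite invr_eq0.
  exists (inl (inr (t, c / y))) => //; rewrite inE mem_cat [X in [|| _, X | _]]map_f ?orbT //.
  apply/(meeting_paramsP h_monic size_h rsP).
  set k := c / y in eA *.
  have [|E1 E2 _ _] := @cubic_coefs_eq0 K (k * (odd_part_at h`_3 h`_1 t - k))
    (quintic_at h`_4 h`_3 h`_2 h`_1 h`_0 t - 2%:R * k * t) 0 0 two0.
    move=> s r; have := on_span _ _ eA s r.
    rewrite !mxE /= !(mulr0, mulr1, addr0, add0r) quintic_form_meeting => e.
    by rewrite -[RHS]e; ring.
  by split=> //; exact: subr0_eq.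
(* The coefficient of s r^2 is - y; once y = 0, that of s^2 r is x^2, so only the axis remains. *)
- have [|_ xE yE _] := @cubic_coefs_eq0 K
    (h`_4 * (x ^+ 2 * c) + h`_2 * (x * y * c) + h`_0 * (y ^+ 2 * c) + x * c ^+ 2)
    (x ^+ 2 + h`_3 * (x * y) + h`_1 * y ^+ 2) (- y) 0 two0.
    move=> s r; rewrite -[RHS](on_span _ _ eA s r) !mxE /=.
    by rewrite /quintic_form; ring.
  have y0 : y = 0 by apply: oppr_inj; rewrite oppr0.
  have x0 : x = 0.
    by apply/eqP; rewrite -sqrf_eq0; apply/eqP; rewrite -[RHS]xE y0; ring.
  by apply: axis; right; exists c; rewrite x0 y0 in eA.
Qed.

Theorem quintic_surface_lines : exactly_n_rational_lines iota (quintic_surface h)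
  (2 + 3 * size rs + size qs).
Proof.
have -> : (2 + 3 * size rs + size qs)%N =
    size (map (@standard_line K) quintic_params).
  by rewrite size_map size_quintic_params.
apply: exactly_n_rational_linesP => //.
- rewrite map_inj_uniq ?uniq_quintic_params // => l l' e.
  by apply: standard_line_inj; rewrite e; exact: eqmx_refl.
- by move=> _ _ /mapP[l _ ->] /mapP[l' _ ->] /standard_line_inj ->.
- move=> _ /mapP[l sl ->]; split; first exact: row_free_standard_line.
  exact: quintic_params_inL.
move=> A freeA FA; have [|l sl eA] := quintic_params_complete freeA.
  move=> v /submxP[u ->]; apply/eqP; rewrite -(fmorph_eq0 iota).
  by rewrite -form_eval_quintic_surface_map FA.
by exists (standard_line l) => //; exact: map_f.
Qed.

End QuinticLineCount.

(** * The small cases *)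

Section SmallCases.

Variables (K : fieldType) (p : nat).
Hypotheses (p_gt0 : (0 < p)%N) (char0 : forall k, k.+1%:R != 0 :> K).
Hypothesis dvdn_of_expr : forall (x : K) m k,
  (0 < m)%N -> x ^+ m = p%:R ^+ k -> (m %| k)%N.

Lemma p_nat_neq0 : p%:R != 0 :> K.
Proof. exact: natr_neq0. Qed.

(** Otherwise (x / y)^m = p with m > 1, against the valuation property. *)
Lemma expr_eq_pmul m (x y : K) : (1 < m)%N -> x ^+ m = p%:R * y ^+ m ->
  x = 0 /\ y = 0.
Proof.
move=> m1 e; have m0 := ltnW m1.
have y0 : y = 0.
  apply/eqP/negPn/negP => y0.
  have := dvdn_of_expr m0 (_ : (x / y) ^+ m = p%:R ^+ 1).
  rewrite expr_div_n e mulfK ?expf_neq0 // expr1 dvdn1 => /(_ erefl)/eqP m_eq1.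
  by rewrite m_eq1 in m1.
split=> //; apply/eqP; have /eqP := e.
by rewrite y0 expr0n eqn0Ngt m0 mulr0 expf_eq0 m0.
Qed.

Lemma row_free_coord0 (A : 'M[K]_(2, 4)) (j : 'I_4) : row_free A ->
  exists v : 'rV[K]_4, [/\ (v <= A)%MS, v != 0 & v 0 j = 0].
Proof.
move=> freeA; have [k k0 kA] : exists2 k : 'rV[K]_2, k != 0 & k *m col j A = 0.
  have : \rank (kermx (col j A)) != 0.
    by rewrite mxrank_ker subn_eq0 -ltnNge ltnS rank_leq_col.
  rewrite mxrank_eq0 => /rowV0Pn[k /sub_kermxP kA k0].
  by exists k.
exists (k *m A); split; first exact: submxMl.
  by apply: contraNneq k0 => kA0; apply/eqP/(row_free_inj freeA); rewrite mul0mx.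
have <- : (k *m col j A) 0 0 = (k *m A) 0 j.
  by rewrite !mxE; apply: eq_bigr => i _; rewrite mxE.
by rewrite kA mxE.
Qed.

Definition no_line_surface : {mpoly K[4]} :=
  cubic_term 1 x_ x_ x_ + cubic_term (- p%:R) y_ y_ y_
  + cubic_term (-1) z_ z_ w_ + cubic_term (-1) z_ w_ w_.

Definition one_line_surface : {mpoly K[4]} :=
  cubic_term 1 x_ x_ x_ + cubic_term (- p%:R) x_ y_ y_
  + cubic_term (- p%:R) z_ z_ z_ + cubic_term (p%:R ^+ 2) z_ w_ w_.

Lemma no_line_surface_homog : no_line_surface \is 3.-homog.
Proof. by rewrite !rpredD ?cubic_term_homog. Qed.

Lemma one_line_surface_homog : one_line_surface \is 3.-homog.
Proof. by rewrite !rpredD ?cubic_term_homog. Qed.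

Variables (L : closedFieldType) (iota : {rmorphism K -> L}).
Hypothesis algL : algebraic_closure iota.

Lemma natr_neq0_closure k : (0 < k)%N -> k%:R != 0 :> L.
Proof. by move=> k_gt0; rewrite -(rmorph_nat iota) fmorph_eq0; exact: natr_neq0. Qed.

Lemma form_eval_no_line v : form_eval iota no_line_surface v =
  v 0 x_ ^+ 3 - p%:R * v 0 y_ ^+ 3 - v 0 z_ * v 0 w_ * (v 0 z_ + v 0 w_).
Proof.
rewrite /no_line_surface !form_evalD !form_eval_cubic_term !rmorphN rmorph1 rmorph_nat.
by ring.
Qed.

Lemma form_eval_one_line v : form_eval iota one_line_surface v =
  v 0 x_ ^+ 3 - p%:R * (v 0 x_ * v 0 y_ ^+ 2) - p%:R * v 0 z_ ^+ 3
  + p%:R ^+ 2 * (v 0 z_ * v 0 w_ ^+ 2).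
Proof.
rewrite /one_line_surface !form_evalD !form_eval_cubic_term !rmorphN rmorphXn rmorph1 rmorph_nat.
by ring.
Qed.

Lemma smooth_surface_gradient (F : {mpoly K[4]}) :
  (forall v, (forall i, form_eval iota F^`M(i) v = 0) -> v = 0) ->
  smooth_surface iota F.
Proof.
move=> H v v0 _; apply: contrapT => /forallNP dF; case/eqP: v0.
by apply: H => i; apply/eqP/negPn/negP; exact: dF.
Qed.

Lemma no_line_surface_smooth : smooth_surface iota no_line_surface.
Proof.
apply: smooth_surface_gradient => v dF0.
have three0 := natr_neq0_closure (isT : (0 < 3)%N).
have p0 := natr_neq0_closure p_gt0.
have := (dF0 x_, dF0 y_, dF0 z_, dF0 w_).
rewrite /no_line_surface !mderivD !form_evalD !form_eval_mderiv_cubic_term /=.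
rewrite !rmorphN rmorph1 rmorph_nat => -[[[Fx Fy] Fz] Fw].
move: (v 0 x_) (v 0 y_) (v 0 z_) (v 0 w_) Fx Fy Fz Fw (@eq_vec4 L v 0).
rewrite !mxE => x y z w Fx Fy Fz Fw eq_v0.
have z2 : z ^+ 2 = - (2%:R * z * w).
  by apply: oppr_inj; apply: subr0_eq; rewrite -[RHS]Fw; ring.
have w2 : w ^+ 2 = - (2%:R * z * w).
  by apply: oppr_inj; apply: subr0_eq; rewrite -[RHS]Fz; ring.
have zw0 : z * w = 0.
  apply/eqP; rewrite -sqrf_eq0; apply/eqP/(mulfI three0)/oppr_inj.
  transitivity (z ^+ 2 * w ^+ 2 - (2%:R * z * w) ^+ 2); first by ring.
  by rewrite z2 w2; ring.
apply: eq_v0.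
- apply/eqP; rewrite -sqrf_eq0; apply/eqP/(mulfI three0).
  by rewrite mulr0 -[RHS]Fx; ring.
- apply/eqP; rewrite -sqrf_eq0; apply/eqP/(mulfI three0)/(mulfI p0)/oppr_inj.
  by rewrite !mulr0 oppr0 -[RHS]Fy; ring.
- by apply/eqP; rewrite -sqrf_eq0 z2 -mulrA zw0 mulr0 oppr0.
- by apply/eqP; rewrite -sqrf_eq0 w2 -mulrA zw0 mulr0 oppr0.
Qed.

(* x (x^2 - p y^2) is squarefree, so its two partials only vanish at 0. *)
Lemma binary_gradient_eq0 (x y : L) : 3%:R * x ^+ 2 - p%:R * y ^+ 2 = 0 ->
  x * y = 0 -> x = 0 /\ y = 0.
Proof.
have three0 := natr_neq0_closure (isT : (0 < 3)%N).
have p0 := natr_neq0_closure p_gt0.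
move=> e /eqP; rewrite mulf_eq0 => /orP[]/eqP c0; split=> //; apply/eqP;
  rewrite -sqrf_eq0; apply/eqP.
  by apply: (mulfI p0); apply: oppr_inj; rewrite mulr0 oppr0 -[RHS]e c0; ring.
by apply: (mulfI three0); rewrite mulr0 -[RHS]e c0; ring.
Qed.

Lemma one_line_surface_smooth : smooth_surface iota one_line_surface.
Proof.
apply: smooth_surface_gradient => v dF0.
have two0 := natr_neq0_closure (isT : (0 < 2)%N).
have p0 := natr_neq0_closure p_gt0.
have := (dF0 x_, dF0 y_, dF0 z_, dF0 w_).
rewrite /one_line_surface !mderivD !form_evalD !form_eval_mderiv_cubic_term /=.
rewrite !rmorphN rmorphXn rmorph1 rmorph_nat => -[[[Fx Fy] Fz] Fw].
move: (v 0 x_) (v 0 y_) (v 0 z_) (v 0 w_) Fx Fy Fz Fw (@eq_vec4 L v 0).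
rewrite !mxE => x y z w Fx Fy Fz Fw eq_v0.
have [|| x0 y0] := @binary_gradient_eq0 x y.
- by rewrite -[RHS]Fx; ring.
- apply: (mulfI two0); apply: (mulfI p0); apply: oppr_inj.
  by rewrite !mulr0 oppr0 -[RHS]Fy; ring.
have [|| z0 w0] := @binary_gradient_eq0 z w; last exact: eq_v0.
- by apply: (mulfI p0); apply: oppr_inj; rewrite mulr0 oppr0 -[RHS]Fz; ring.
- apply: (mulfI two0); apply: (mulfI p0); apply: (mulfI p0).
  by rewrite !mulr0 -[RHS]Fw; ring.
Qed.

(** A rational line meets w = 0 and z = 0 in points with x^3 = p y^3, hence with x = y = 0. It is
    then the line x = y = 0, on which z w (z + w) does not vanish. *)
Lemma no_line_surface_lines : exactly_n_rational_lines iota no_line_surface 0.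
Proof.
apply: (@exactly_n_rational_linesP _ _ _ algL char0 _ [::]) => // A freeA FA; exfalso.
have two0 : 2%:R != 0 :> K := char0 1.
have FK (v : 'rV[K]_4) : (v <= A)%MS ->
    v 0 x_ ^+ 3 = p%:R * v 0 y_ ^+ 3 + v 0 z_ * v 0 w_ * (v 0 z_ + v 0 w_).
  move=> /submxP[u ->]; apply: subr0_eq; apply/eqP; rewrite -(fmorph_eq0 iota).
  rewrite -[X in _ == X](FA u) form_eval_no_line ![map_mx iota _ _ _]mxE.
  rewrite rmorphB !(rmorph_nat, rmorphXn, rmorphD, rmorphM); apply/eqP; ring.
have [v [vA v0 vw]] := row_free_coord0 w_ freeA.
have [u [uA u0 uz]] := row_free_coord0 z_ freeA.
have [vx vy] : v 0 x_ = 0 /\ v 0 y_ = 0.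
  by apply: (@expr_eq_pmul 3) => //; rewrite FK // vw; ring.
have [ux uy] : u 0 x_ = 0 /\ u 0 y_ = 0.
  by apply: (@expr_eq_pmul 3) => //; rewrite FK // uz; ring.
have vz : v 0 z_ != 0.
  by apply: contraNneq v0 => vz; apply/eqP/eq_vec4; rewrite ?vx ?vy ?vz ?vw mxE.
have uw : u 0 w_ != 0.
  by apply: contraNneq u0 => uw; apply/eqP/eq_vec4; rewrite ?ux ?uy ?uz ?uw mxE.
have F1 := FK _ (addmx_sub vA uA).
have F2 := FK _ (addmx_sub vA (scalemx_sub (-1) uA)).
rewrite !mxE vx vy vw ux uy uz in F1 F2.
have /eqP : 2%:R * (v 0 z_ * (u 0 w_ * u 0 w_)) = 0.
  have {}F1 : v 0 z_ * u 0 w_ * (v 0 z_ + u 0 w_) = 0.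
    move/eqP: F1; rewrite -subr_eq0 => /eqP F1.
    by apply: oppr_inj; rewrite oppr0 -[RHS]F1; ring.
  have {}F2 : v 0 z_ * u 0 w_ * (v 0 z_ - u 0 w_) = 0.
    by move/eqP: F2; rewrite -subr_eq0 => /eqP F2; rewrite -[RHS]F2; ring.
  rewrite -[RHS](subr0 0) -[X in _ = X - _]F1 -[X in _ = _ - X]F2; ring.
by rewrite !mulf_eq0 (negPf two0) (negPf vz) (negPf uw).
Qed.

(** Rational points of the surface with z = 0 also have x = 0, as p is not a square. A rational line
    outside the plane z = 0 would yield a cube root of p. *)
Lemma one_line_surface_lines : exactly_n_rational_lines iota one_line_surface 1.
Proof.
pose l : 'M[K]_(2, 4) := span2 (vec4 0 1 0 0) (vec4 0 0 0 1).
have free_l : row_free l.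
  apply: row_free_span2 => s t /rowP e; have := (e y_, e w_); rewrite !mxE /=.
  by rewrite !mulr0 !mulr1 addr0 add0r => -[-> ->].
apply: (@exactly_n_rational_linesP _ _ _ algL char0 _ [:: l]) => //.
- by move=> A B; rewrite !inE => /eqP-> /eqP->.
- move=> A; rewrite inE => /eqP->; split=> // u.
  rewrite form_eval_one_line map_span2 mul_span2 !mxE /= !(rmorph0, rmorph1).
  by ring.
move=> A freeA FA; exists l; first exact: mem_head.
have two0 : 2%:R != 0 :> K := char0 1.
have p0 := p_nat_neq0.
have FK (v : 'rV[K]_4) : (v <= A)%MS ->
    v 0 x_ * (v 0 x_ ^+ 2 - p%:R * v 0 y_ ^+ 2)
    = p%:R * v 0 z_ * (v 0 z_ ^+ 2 - p%:R * v 0 w_ ^+ 2).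
  move=> /submxP[u ->]; apply: subr0_eq; apply/eqP; rewrite -(fmorph_eq0 iota).
  rewrite -[X in _ == X](FA u) form_eval_one_line ![map_mx iota _ _ _]mxE.
  by rewrite !(rmorph_nat, rmorphXn, rmorphB, rmorphD, rmorphM); apply/eqP; ring.
have zx (v : 'rV[K]_4) : (v <= A)%MS -> v 0 z_ = 0 -> v 0 x_ = 0.
  move=> vA vz; have /eqP := FK v vA; rewrite vz mulr0 mul0r mulf_eq0.
  by case/orP=> [/eqP // |]; rewrite subr_eq0 => /eqP/expr_eq_pmul[].
have [zA0 | /existsNP[u /not_implyP[uA /eqP uz]]] :=
    pselect (forall v : 'rV[K]_4, (v <= A)%MS -> v 0 z_ = 0).
  apply: eqmx_of_sub_row_free => //.
  apply/row_subP => i; apply/sub_span2P.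
  have iA := row_sub i A; have iz := zA0 _ iA; have ix := zx _ iA iz.
  exists (row i A 0 y_), (row i A 0 w_).
  by apply: eq_vec4; rewrite ?ix ?iz !mxE /= ?mulr0 ?mulr1 ?addr0 ?add0r.
exfalso; have [v [vA v0 vz]] := row_free_coord0 z_ freeA.
have vx := zx v vA vz.
pose r := (u 0 z_)^-1 *: u; have rA : (r <= A)%MS by exact: scalemx_sub.
have rz : r 0 z_ = 1 by rewrite mxE mulVf.
move: r rA rz => r rA rz.
(* Only the y- and w-coordinates vary with s, so the equation has degree 2 in s; the values s = 0,
   1, -1 isolate its coefficients. *)
have Fs s := FK (r + s *: v) (addmx_sub rA (scalemx_sub s vA)).
have {}Fs s : (r 0 x_ ^+ 3 - p%:R * r 0 x_ * r 0 y_ ^+ 2 - p%:R + p%:R ^+ 2 * r 0 w_ ^+ 2)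
    + 2%:R * p%:R * (p%:R * r 0 w_ * v 0 w_ - r 0 x_ * r 0 y_ * v 0 y_) * s
    + p%:R * (p%:R * v 0 w_ ^+ 2 - r 0 x_ * v 0 y_ ^+ 2) * s ^+ 2 = 0.
  have := Fs s; rewrite !mxE rz vz vx => /eqP; rewrite -subr_eq0 => /eqP e.
  by rewrite -[RHS]e; ring.
have vyw : (v 0 y_ == 0) && (v 0 w_ == 0) = false.
  apply/negP => /andP[/eqP vy /eqP vw]; case/eqP: v0.
  by apply: eq_vec4; rewrite ?vx ?vy ?vz ?vw mxE.
move: (r 0 x_) (r 0 y_) (r 0 w_) (v 0 y_) (v 0 w_) Fs vyw => x y w y0 w0 Fs vyw.
have C0 : x ^+ 3 - p%:R * x * y ^+ 2 - p%:R + p%:R ^+ 2 * w ^+ 2 = 0.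
  by rewrite -[RHS](Fs 0); ring.
have C2 : p%:R * w0 ^+ 2 = x * y0 ^+ 2.
  apply: subr0_eq; apply: (mulfI two0); apply: (mulfI p0); rewrite !mulr0.
  transitivity (0 + 0 - 2%:R * 0 : K); last by ring.
  rewrite -[X in _ = X + _ - _](Fs 1) -[X in _ = _ + X - _](Fs (-1)).
  by rewrite -[X in _ = _ - _ * X]C0; ring.
have C1 : p%:R * w * w0 = x * y * y0.
  apply: subr0_eq; apply: (mulfI two0); apply: (mulfI two0); apply: (mulfI p0); rewrite !mulr0.
  transitivity (0 - 0 : K); last by ring.
  by rewrite -[X in _ = X - _](Fs 1) -[X in _ = _ - X](Fs (-1)); ring.
have x0 : x != 0.
  apply/eqP => x0; have one_w : 1 ^+ 2 = p%:R * w ^+ 2.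
    apply: subr0_eq; apply: (mulfI p0); apply: oppr_inj.
    by rewrite mulr0 oppr0 -[RHS]C0 x0; ring.
  have [/eqP] := expr_eq_pmul (isT : (1 < 2)%N) one_w.
  by rewrite oner_eq0.
have y00 : y0 != 0.
  apply/eqP => y00; move: vyw; rewrite y00 eqxx /= => /negP; apply.
  by rewrite -sqrf_eq0; apply/eqP/(mulfI p0); rewrite mulr0 C2 y00; ring.
(* The square of [C1] divided by [C2]; it reduces [C0] to x^3 = p. *)
have C3 : p%:R * w ^+ 2 = x * y ^+ 2.
  have xy0 : x * y0 ^+ 2 != 0 by rewrite mulf_neq0 ?expf_eq0.
  apply: (mulfI xy0); rewrite -{1}C2.
  transitivity ((p%:R * w * w0) ^+ 2); first by ring.
  by rewrite C1; ring.
have x3 : x ^+ 3 = p%:R * 1 ^+ 3.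
  apply: subr0_eq; rewrite -[RHS]C0.
  transitivity (x ^+ 3 - p%:R + p%:R * (p%:R * w ^+ 2 - x * y ^+ 2)); last by ring.
  by rewrite C3; ring.
have [_ /eqP] := expr_eq_pmul (isT : (1 < 3)%N) x3.
by rewrite oner_eq0.
Qed.

End SmallCases.

(** * The choice of the quintics *)

Lemma quintic_surface_exists (K : fieldType) (p : nat) (D : seq (nat * nat)) :
  (0 < p)%N -> (forall k, k.+1%:R != 0 :> K) ->
  (forall (x : K) m k, (0 < m)%N -> x ^+ m = p%:R ^+ k -> (m %| k)%N) ->
  uniq D -> all (fun d => [&& 0 < d.1, 0 < d.2 & d.2 <= 5]%N) D ->
  (\sum_(d <- D) d.2 = 5)%N ->
  let a := count (fun d => d.2 == 1%N) D in let b := count (fun d => d.2 == 2) D in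
  exists F : {mpoly K[4]}, F \is 3.-homog /\
    forall (L : closedFieldType) (iota : {rmorphism K -> L}), algebraic_closure iota ->
      smooth_surface iota F /\
      exactly_n_rational_lines iota F (2 + 3 * a + ('C(a, 2) + b)).
Proof.
move=> p_gt0 char0 dvdn_of_expr uD /allP allD sumD a b.
have DP d : d \in D -> [/\ (0 < d.1)%N, (0 < d.2)%N & (d.2 <= 5)%N].
  by move/allD/and3P.
exists (quintic_surface (shifted_power_prod K p D)); split.
  exact: quintic_surface_homog.
move=> L iota algL.
have h_monic := shifted_power_prod_monic K p DP.
have size_h : size (shifted_power_prod K p D) = 6.
  by rewrite size_shifted_power_prod // sumD.
have h_sep := shifted_power_prod_separable p_gt0 char0 dvdn_of_expr uD DP.
have h_reflect := shifted_power_prod_reflect char0 dvdn_of_expr DP.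
split; first exact: quintic_surface_smooth.
rewrite {}/a {}/b -(size_product_quads K p D) -(size_product_roots K p D).
apply: quintic_surface_lines => //.
- move=> t; exact: product_rootsP.
- exact: uniq_product_roots.
- move=> u v; exact: product_quadsP.
- exact: uniq_product_quads.
Qed.

Theorem theorem1p1 (p : nat) (p_pr : prime p) (n : nat)
    (n_val : n \in [:: 0; 1; 2; 3; 5; 7; 9; 15; 27]%N) :
  exists F : {mpoly (padic p_pr)[4]},
    F \is 3.-homog /\
    forall (L : closedFieldType) (iota : {rmorphism padic p_pr -> L}),
      algebraic_closure iota ->
      smooth_surface iota F /\ exactly_n_rational_lines iota F n.
Proof.
have p_gt0 := prime_gt0 p_pr.
have char0 := @natr_padic_neq0 p p_pr.
have valp := @dvdn_of_padic_expr p p_pr.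
have quintic D := @quintic_surface_exists (padic p_pr) p D p_gt0 char0 valp.
move: n_val; rewrite !inE.
case/predU1P=> [-> | ].
  exists (no_line_surface (padic p_pr) p); split; first exact: no_line_surface_homog.
  move=> L iota algL; split; first exact: no_line_surface_smooth.
  exact: no_line_surface_lines.
case/predU1P=> [-> | ].
  exists (one_line_surface (padic p_pr) p); split; first exact: one_line_surface_homog.
  move=> L iota algL; split; first exact: one_line_surface_smooth.
  exact: one_line_surface_lines.
(* The degrees in each list form a partition of 5, here 5 itself, then 2+3, 1+4, 1+2+2, 1+1+3,
   1+1+1+2 and 1+1+1+1+1; distinct shifts separate factors of equal degree. *)
case/predU1P=> [-> | ].
  by apply: (quintic [:: (1, 5)]%N); rewrite // !big_cons big_nil.
case/predU1P=> [-> | ].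
  by apply: (quintic [:: (1, 2); (1, 3)]%N); rewrite // !big_cons big_nil.
case/predU1P=> [-> | ].
  by apply: (quintic [:: (1, 1); (1, 4)]%N); rewrite // !big_cons big_nil.
case/predU1P=> [-> | ].
  by apply: (quintic [:: (1, 1); (1, 2); (2, 2)]%N); rewrite // !big_cons big_nil.
case/predU1P=> [-> | ].
  by apply: (quintic [:: (1, 1); (2, 1); (1, 3)]%N); rewrite // !big_cons big_nil.
case/predU1P=> [-> | /eqP->].
  by apply: (quintic [:: (1, 1); (2, 1); (3, 1); (1, 2)]%N); rewrite // !big_cons big_nil.
by apply: (quintic [:: (1, 1); (2, 1); (3, 1); (4, 1); (5, 1)]%N); rewrite // !big_cons big_nil.
Qed.
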